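(* Let $\varphi$ be a function of $\ell$. Suppose that for every weight vector $w\in(0,\infty)^\ell$ there is a deterministic online algorithm for the soft allocation problem in dimension $\ell$ with weights $w$ that is $\varphi(\ell)$-competitive. Then there is an $O(\varphi(\ell))$-competitive randomized algorithm for weighted interleaved myopic paging (WIMP) with $\ell$ weight classes (the constant in $O(\cdot)$ being absolute).
   Context: Soft allocation problem in dimension $\ell$ with weights $w\in(0,\infty)^\ell$: an algorithm maintains a point $x(t)\in\Delta^{\ell-1}=\{x\in[0,1]^\ell:\sum_i x_i=1\}$. At each time $t=1,2,\dots$ a direction $r_t\in\{1,\dots,\ell\}$ and a non-increasing function $f_t:[0,1]\to\mathbb{R}_{\ge0}\cup\{\infty\}$ are revealed; the algorithm moves from $x(t-1)$ to $x(t)$ (online: knowing only data revealed so far), paying $\sum_i w_i|x_i(t)-x_i(t-1)|+f_t(x_{r_t}(t))$; the goal is to minimize total cost. Weighted paging: pages with weights $w_p>0$, cache of size $k$, request sequence $\sigma_1,\sigma_2,\dots$; after time $t$ the cache must contain $\sigma_t$; loading page $p$ costs $w_p$. There are $\ell$ weight classes if weights take $\ell$ distinct values $w_1,\dots,w_\ell$. WIMP: when serving the request at time $t$, the algorithm knows $\sigma_1,\dots,\sigma_t$ and, for each pair of pages $p,p'$ of the same weight class, which of the two is requested earlier after time $t$, and nothing else about the future (in particular nothing about how requests of different classes interleave). Competitive ratio $\rho$ (for either problem): cost (expected cost for randomized algorithms) at most $\rho\cdot\mathrm{OPT}+b$ for a constant $b$ independent of the request sequence. *)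

(* Defs.v *)
From HB Require Import structures.
From mathcomp Require Import all_boot all_order all_algebra.
From mathcomp Require Import finmap.
From mathcomp Require Import all_classical all_reals all_analysis.

Set Implicit Arguments.
Unset Strict Implicit.
Unset Printing Implicit Defensive.

Import Order.TTheory GRing.Theory Num.Theory.
Local Open Scope classical_set_scope.
Local Open Scope ring_scope.
Local Open Scope fset_scope.

Section SoftAllocation.
Variables (R : realType) (l : nat).

Definition in_simplex (x : 'I_l -> R) : Prop :=
  (forall i, 0 <= x i <= 1) /\ \sum_(i < l) x i = 1.

Record sa_request := SARequest { sa_dir : 'I_l; sa_fun : R -> \bar R }.

Definition sa_valid_request (q : sa_request) : Prop :=
  (forall x, 0 <= x <= 1 -> (0 <= sa_fun q x)%E) /\
  (forall x y, 0 <= x -> x <= y -> y <= 1 -> (sa_fun q y <= sa_fun q x)%E).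

Definition sa_valid_seq (rs : seq sa_request) : Prop :=
  forall t : 'I_(size rs), sa_valid_request (tnth (in_tuple rs) t).

Definition move_cost (w : 'I_l -> R) (x y : 'I_l -> R) : R :=
  \sum_(i < l) w i * `|y i - x i|.

Definition sa_cost (w : 'I_l -> R) (rs : seq sa_request) (x : nat -> 'I_l -> R)
  : \bar R :=
  (\sum_(t < size rs)
     ((move_cost w (x t) (x t.+1))%:E
      + sa_fun (tnth (in_tuple rs) t) (x t.+1 (sa_dir (tnth (in_tuple rs) t)))))%E.

(* A deterministic online algorithm: the point x(t) is a function of the
   requests revealed so far (x(0) = A [::]). *)
Definition sa_alg := seq sa_request -> ('I_l -> R).

Definition sa_traj (A : sa_alg) (rs : seq sa_request) : nat -> 'I_l -> R :=
  fun t => A (take t rs).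

Definition sa_alg_valid (A : sa_alg) : Prop :=
  forall rs, sa_valid_seq rs -> in_simplex (A rs).

Definition sa_opt (w : 'I_l -> R) (x0 : 'I_l -> R) (rs : seq sa_request) : \bar R :=
  ereal_inf [set sa_cost w rs y | y in
     [set y : nat -> 'I_l -> R | y 0%N = x0 /\
        forall t, (t <= size rs)%N -> in_simplex (y t)]].

Definition sa_competitive (w : 'I_l -> R) (A : sa_alg) (rho : R) : Prop :=
  exists b : R, forall rs, sa_valid_seq rs ->
    (sa_cost w rs (sa_traj A rs) <= rho%:E * sa_opt w (A [::]) rs + b%:E)%E.

End SoftAllocation.

Section Paging.
Variables (R : realType) (P : choiceType).

Definition paging_cost (wt : P -> R) (sigma : seq P) (C : nat -> {fset P}) : R :=
  \sum_(t < size sigma) \sum_(p <- C t.+1 `\` C t) wt p.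

Definition paging_feasible (k : nat) (sigma : seq P) (C : nat -> {fset P}) : Prop :=
  C 0%N = fset0 /\
  forall t : 'I_(size sigma),
    tnth (in_tuple sigma) t \in C t.+1 /\ (#|` C t.+1| <= k)%N.

Definition paging_opt (k : nat) (wt : P -> R) (sigma : seq P) : \bar R :=
  ereal_inf [set (paging_cost wt sigma C)%:E | C in
               [set C | paging_feasible k sigma C]].

Definition next_req (sigma : seq P) (t : nat) (p : P) : option nat :=
  if p \in drop t sigma then Some (index p (drop t sigma)) else None.

Definition req_earlier (sigma : seq P) (t : nat) (p q : P) : bool :=
  match next_req sigma t p, next_req sigma t q with
  | Some i, Some j => (i < j)%N
  | Some _, None => true
  | None, _ => false
  end.

(* WIMP information about the future at time t: the "requested earlier"
   relation restricted to pairs of pages of the same weight class *)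
Definition wimp_rel (l : nat) (cls : P -> 'I_l) (sigma : seq P) (t : nat)
  : P -> P -> bool :=
  fun p q => (cls p == cls q) && req_earlier sigma t p q.

(* A randomized WIMP algorithm: given the random seed, the prefix
   sigma_1..sigma_t and the WIMP relation at time t, it outputs the cache
   after time t. *)
Definition wimp_alg (Omega : Type) := Omega -> seq P -> (P -> P -> bool) -> {fset P}.

Definition wimp_cache (l : nat) (cls : P -> 'I_l) (Omega : Type)
  (alg : wimp_alg Omega) (om : Omega) (sigma : seq P) : nat -> {fset P} :=
  fun t => if t is 0%N then fset0 else alg om (take t sigma) (wimp_rel cls sigma t).

Definition wimp_rand_competitive (l : nat) (k : nat) (cls : P -> 'I_l)
  (wc : 'I_l -> R) (d : measure_display) (Omega : measurableType d)
  (Pr : probability Omega R) (alg : wimp_alg Omega) (rho : R) : Prop :=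
  let wt := fun p => wc (cls p) in
  (forall om sigma, paging_feasible k sigma (wimp_cache cls alg om sigma)) /\
  (forall sigma, measurable_fun setT
       (fun om => paging_cost wt sigma (wimp_cache cls alg om sigma))) /\
  exists b : R, forall sigma,
    (\int[Pr]_om (paging_cost wt sigma (wimp_cache cls alg om sigma))%:E
       <= rho%:E * paging_opt k wt sigma + b%:E)%E.

End Paging.

(* Main.v *)
(** Each class keeps its pages in the order of a Belady stack: a request moves
    to the top and every displaced page sinks past the pages requested before
    it, so that for every [m] the first [m] pages of the stack form the cache of
    the farthest-in-future rule with [m] slots.  Serving the requests of a class
    with a varying number of slots in this way costs, up to a constant factor,
    no more than any other schedule with the same numbers of slots.  It remains
    to decide how many of the [k] slots each class gets, and this is a soft
    allocation problem: a request at depth [a] of its stack costs [w_r] times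
    the part of the [a]-th slot that the class lacks, and is infinite below one
    slot, since the requested page must be in the cache.

    The fractional slots [y_i] of the deterministic algorithm are rounded at
    random.  At time [t] there are [2 ^ t] equally likely integral allocations
    (rows) whose column averages are the [y_i] rounded down to multiples of
    [2 ^- t].  They are balanced: in each column, and in each sum of the columns
    of the classes of weight at least [2 ^ s], entries differ by at most one.
    Balance bounds the size of every cache by [k], and moving a column sum by one
    costs only a constant times the weight of the class, the repairs needed at
    the lower weight levels forming a geometric sum.  The rounding errors are
    summable in [t], hence contribute an additive constant. *)

Require Import Defs.
From HB Require Import structures.
From mathcomp Require Import all_boot all_order all_algebra.
From mathcomp Require Import finmap.
From mathcomp Require Import all_classical all_reals all_analysis.
From mathcomp Require Import measurable_realfun.
From mathcomp Require Import zify ring lra.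

Set Implicit Arguments.
Unset Strict Implicit.
Unset Printing Implicit Defensive.

Import Order.TTheory GRing.Theory Num.Theory.

(** * Belady stacks *)

Lemma perm_consCA (T : eqType) (x y : T) s :
  perm_eql (x :: y :: s) (y :: x :: s).
Proof. exact: (perm_catCA [:: x] [:: y]). Qed.

Section BeladyStack.
Variables (P : choiceType).
Implicit Types (earlier : rel P) (s : seq P).

(** [c] is the page being carried down; at each place the page requested earlier stays. This is the
    priority update of a stack algorithm, with next request times as priorities. *)
Fixpoint sink earlier (c : P) s (p : P) : seq P :=
  match s with
  | [::] => [:: c]
  | q :: s' => if q == p then c :: s'
               else if earlier q c then q :: sink earlier c s' p
               else c :: sink earlier q s' p
  end.

Definition stack_update earlier s p : seq P :=
  match s with
  | [::] => [:: p]
  | q :: s' => if q == p then s else p :: sink earlier q s' p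
  end.

Lemma sink_perm earlier c s p : uniq s -> p \in s ->
  perm_eq (p :: sink earlier c s p) (c :: s).
Proof.
elim: s c => //= q s IHs c /andP[qNs us].
rewrite inE; have [<- _|neq /= ps] := eqVneq q p.
  by rewrite perm_consCA.
case: ifP => _.
  rewrite perm_consCA perm_sym perm_consCA.
  by rewrite perm_cons perm_sym IHs.
by rewrite perm_consCA perm_cons IHs.
Qed.

Lemma sink_perm_new earlier c s p : p \notin s ->
  perm_eq (sink earlier c s p) (c :: s).
Proof.
elim: s c => //= q s IHs c; rewrite inE negb_or eq_sym => /andP[/negPf -> ps].
case: ifP => _; last by rewrite perm_cons IHs.
by rewrite perm_sym perm_consCA perm_cons perm_sym IHs.
Qed.

(** The sinking stops at the old place of [p], inside the prefix, so the prefix only trades [p] for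
    [c]. *)
Lemma take_sink_perm earlier c s p n : uniq s -> p \in take n s ->
  perm_eq (p :: take n (sink earlier c s p)) (c :: take n s).
Proof.
elim: s n c => [|q s IHs] [|n] c //= /andP[qNs us].
rewrite inE; have [<- _|neq /= ps] := eqVneq q p.
  by rewrite /= perm_consCA.
case: ifP => _ /=.
  rewrite perm_consCA perm_sym perm_consCA.
  by rewrite perm_cons perm_sym IHs.
by rewrite perm_consCA perm_cons IHs.
Qed.

(* [D] ranges over the sets of pages requested before a given deadline; the
   element [q] that drops out is one whose next request is last. *)
Lemma take_sink_loser earlier c s p n : p \notin take n s -> (n <= size s)%N ->
  exists q, [/\ q \in c :: take n s,
    perm_eq (q :: take n (sink earlier c s p)) (c :: take n s) &
    forall D : pred P,
      {in c :: take n s &, forall x y, earlier x y -> D y -> D x} ->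
      {in c :: take n s &, forall x y, ~~ earlier x y -> D x -> D y} ->
      D q -> all D (c :: take n s)].
Proof.
elim: n s c => [|n IHn] [|x s] c //=.
- by exists c; split => [||D _ _ ->]; rewrite ?take0 ?mem_head.
- by exists c; split => [||D _ _ ->]; rewrite ?take0 ?mem_head.
rewrite inE negb_or ltnS => /andP[pNx pNs] les.
rewrite eq_sym (negPf pNx); case: ifPn => exc.
  have [q [qin perm Dq]] := IHn s c pNs les.
  exists q; split.
  - by move: qin; rewrite !inE => /orP[->//|->]; rewrite !orbT.
  - rewrite perm_consCA perm_sym perm_consCA.
    by rewrite perm_cons perm_sym.
  - move=> D De Dl /Dq Dcs; have /= /andP[Dc Ds] : all D (c :: take n s).
      have sub : {subset c :: take n s <= c :: x :: take n s}.
        by move=> y; rewrite !inE => /orP[|] ->; rewrite ?orbT.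
      by apply: Dcs => y z /sub yin /sub zin; [apply: De|apply: Dl].
    by rewrite /= Dc Ds (De x c) ?inE ?eqxx ?orbT.
have [q [qin perm Dq]] := IHn s x pNs les.
exists q; split.
- by rewrite inE qin orbT.
- by rewrite perm_consCA perm_cons.
- move=> D De Dl /Dq Dxs; have /= /andP[Dx Ds] : all D (x :: take n s).
    by apply: Dxs => y z yin zin; [apply: De|apply: Dl]; rewrite inE ?yin ?zin orbT.
  by rewrite /= Dx Ds (Dl x c) ?inE ?eqxx ?orbT.
Qed.

Lemma stack_update_perm earlier s p : uniq s -> p \in s ->
  perm_eq (stack_update earlier s p) s.
Proof.
case: s => //= q s /andP[qNs us]; rewrite inE eq_sym.
by have [|_ /= ps] := eqVneq q p => //; apply: sink_perm.
Qed.

Lemma stack_update_perm_new earlier s p : p \notin s ->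
  perm_eq (stack_update earlier s p) (p :: s).
Proof.
case: s => //= q s; rewrite inE negb_or eq_sym => /andP[/negPf -> ps].
by rewrite perm_cons sink_perm_new.
Qed.

Lemma stack_update_uniq earlier s p : uniq s -> uniq (stack_update earlier s p).
Proof.
move=> us; have [ps|ps] := boolP (p \in s).
  by rewrite (perm_uniq (stack_update_perm earlier us ps)).
by rewrite (perm_uniq (stack_update_perm_new earlier ps)) /= ps.
Qed.

Lemma mem_stack_update earlier s p : uniq s ->
  stack_update earlier s p =i p :: s.
Proof.
move=> us x; have [ps|ps] := boolP (p \in s).
  rewrite (perm_mem (stack_update_perm earlier us ps)) inE.
  by case: eqVneq => [->|].
by rewrite (perm_mem (stack_update_perm_new earlier ps)).
Qed.

Lemma mem_take_stack_update_top earlier s p n : (0 < n)%N ->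
  p \in take n (stack_update earlier s p).
Proof.
case: n => // n _; case: s => [|q s] /=; first by rewrite mem_head.
by have [->|_] := eqVneq q p; rewrite mem_head.
Qed.

Lemma take_stack_update_hit earlier s p n : uniq s -> p \in take n s ->
  take n (stack_update earlier s p) =i take n s.
Proof.
case: n s => [|n] [|q s] //= /andP[qNs us].
rewrite inE eq_sym; have [//|_ /= ps] := eqVneq q p.
by move=> x; rewrite /= (perm_mem (take_sink_perm earlier q us ps)).
Qed.

(** Every page but [p] keeps its place or sinks, so none can enter a prefix from below. *)
Lemma take_stack_update_sub earlier s p n : uniq s ->
  {subset take n (stack_update earlier s p) <= p :: take n s}.
Proof.
move=> us x; have [pin|pNin] := boolP (p \in take n s).
  by rewrite take_stack_update_hit // inE => ->; rewrite orbT.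
have [le_s|lt_s] := leqP (size s) n.
  by rewrite (take_oversize le_s) => /mem_take; rewrite mem_stack_update.
case: n s us pNin lt_s => [|n] [|q s] //= _; first by rewrite take0.
rewrite inE negb_or eq_sym => /andP[/negPf -> pNin] /=.
rewrite ltnS => /ltnW le_n; have [z [_ perm _]] := take_sink_loser earlier q pNin le_n.
rewrite !inE => /orP[->//|xin]; apply/orP; right.
by rewrite -in_cons -(perm_mem perm) inE xin orbT.
Qed.

(** The old top is the first page carried, so the loser of [take_sink_loser] is taken among all [n]
    pages: Belady's eviction. *)
Lemma take_stack_update_miss earlier s p n : uniq s -> (0 < n <= size s)%N ->
  p \notin take n s -> exists q, [/\ q \in take n s,
    perm_eq (q :: take n (stack_update earlier s p)) (p :: take n s) &
    forall D : pred P,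
      {in take n s &, forall x y, earlier x y -> D y -> D x} ->
      {in take n s &, forall x y, ~~ earlier x y -> D x -> D y} ->
      D q -> all D (take n s)].
Proof.
case: n s => [|n] [|q s] //= _; rewrite ltnS => le_n.
rewrite inE negb_or eq_sym => /andP[/negPf -> pNin].
have [z [zin perm Dz]] := take_sink_loser earlier q pNin le_n.
exists z; split => //=.
by rewrite perm_consCA perm_cons.
Qed.
End BeladyStack.

Lemma count_pred1U (T : eqType) (p : T) (D : pred T) (s : seq T) : uniq s ->
  count (fun x => (x == p) || D x) s = (count D s + ((p \in s) && ~~ D p))%N.
Proof.
elim: s => //= x s IHs /andP[xNs us]; rewrite IHs // inE eq_sym.
have [e|_] /= := eqVneq p x; last by rewrite addnA.
by rewrite e (negPf xNs) addn0; case: (D x) => /=; lia.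
Qed.

Lemma count_take_shrink (T : eqType) (Q : pred T) (s : seq T) m n :
  (count Q (take n s) <= count Q (take m s) + (n - m))%N.
Proof.
have [le_nm|/ltnW le_mn] := leqP n m.
  rewrite -(cat_take_drop n (take m s)) take_takel // count_cat; lia.
rewrite -{1}(subnKC le_mn) takeD count_cat leq_add2l.
by apply: leq_trans (count_size _ _) _; rewrite size_take; case: ltnP.
Qed.

Lemma count_fsetD (T : choiceType) (Q : pred T) (A B : {fset T}) :
  (count Q A + count Q (B `\` A)%fset = count Q B + count Q (A `\` B)%fset)%N.
Proof.
have aux (U V : {fset T}) :
    count Q U = (count Q (U `&` V)%fset + count Q (U `\` V)%fset)%N.
  have /permP -> : perm_eq (U `&` V)%fset [seq x <- U | x \in V].
    by apply: uniq_perm => [||x]; rewrite ?filter_uniq ?fset_uniq // mem_filter inE andbC.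
  have /permP -> : perm_eq (U `\` V)%fset [seq x <- U | x \notin V].
    by apply: uniq_perm => [||x]; rewrite ?filter_uniq ?fset_uniq // mem_filter inE.
  by rewrite -count_cat; apply/permP; rewrite perm_sym perm_filterC.
by rewrite (aux A B) (aux B A) fsetIC; lia.
Qed.

(** * Pages requested before a deadline *)

Section Deadlines.
Variables (P : choiceType) (sigma : seq P).

Definition requested_within (t tau : nat) : pred P :=
  fun x => x \in drop t (take tau sigma).

Lemma requested_within_next p0 t tau x : (t < tau)%N -> (t < size sigma)%N ->
  requested_within t tau x =
  (x == nth p0 sigma t) || requested_within t.+1 tau x.
Proof.
move=> lt_tau lt_t; rewrite /requested_within (drop_nth p0) ?inE ?nth_take //.
by rewrite size_take; case: ifP.
Qed.

Lemma requested_within_empty t tau x : (tau <= t)%N ->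
  requested_within t tau x = false.
Proof.
by move=> le; rewrite /requested_within drop_oversize // size_take; case: ltnP; lia.
Qed.

Lemma requested_within_index t tau x : requested_within t tau x =
  (x \in drop t sigma) && (index x (drop t sigma) < tau - t)%N.
Proof.
rewrite /requested_within.
have [le|/ltnW lt] := leqP tau t.
  rewrite drop_oversize ?size_take; last by case: ltnP; lia.
  have -> : (tau - t = 0)%N by lia.
  by rewrite ltn0 andbF.
have -> : drop t (take tau sigma) = take (tau - t) (drop t sigma).
  by rewrite take_drop subnK.
apply/idP/andP => [h|[h1 h2]]; last by rewrite in_take.
by have h1 := mem_take h; split; rewrite // -in_take.
Qed.

Lemma requested_within_earlier t tau x y : req_earlier sigma t x y ->
  requested_within t tau y -> requested_within t tau x.
Proof.
rewrite !requested_within_index /req_earlier /next_req.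
by do 2 case: ifP => //=; lia.
Qed.

Lemma requested_within_not_earlier t tau x y : ~~ req_earlier sigma t x y ->
  requested_within t tau x -> requested_within t tau y.
Proof.
rewrite !requested_within_index /req_earlier /next_req.
by do 2 case: ifP => //=; lia.
Qed.
End Deadlines.

(** * Stack faults against the loads of an arbitrary schedule *)

Section Stacks.
Variables (P : choiceType) (l : nat) (cls : P -> 'I_l).

(* A history lists, most recent first, the requested pages together with the
   order information available after each request. *)
Definition history := seq (P * rel P).
Implicit Types h : history.

Fixpoint class_stack h (i : 'I_l) : seq P :=
  match h with
  | [::] => [::]
  | e :: h' => if cls e.1 == i then stack_update e.2 (class_stack h' i) e.1
               else class_stack h' i
  end.

Lemma class_stack_uniq h i : uniq (class_stack h i).
Proof. by elim: h => //= e h IHh; case: ifP => // _; apply: stack_update_uniq. Qed.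

Lemma class_stack_cls h i : {in class_stack h i, forall x, cls x = i}.
Proof.
elim: h => //= e h IHh; case: eqP => // ei x.
by rewrite mem_stack_update ?class_stack_uniq // inE => /orP[/eqP ->|/IHh].
Qed.

Variable p0 : P.

Fixpoint history_of (sigma : seq P) (rels : nat -> rel P) (t : nat) : history :=
  match t with
  | 0 => [::]
  | t'.+1 => (nth p0 sigma t', rels t) :: history_of sigma rels t'
  end.

Variables (sigma : seq P) (C : nat -> {fset P}).

Local Notation h t := (history_of sigma (wimp_rel cls sigma) t).
Local Notation req t := (nth p0 sigma t).

Definition class_slots (t : nat) (i : 'I_l) : nat :=
  count (fun x => cls x == i) (C t).

Definition class_loads (t : nat) (i : 'I_l) : nat :=
  count (fun x => cls x == i) (C t.+1 `\` C t)%fset.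

(** The request is served with the slots that [C] gives the class after it, hence [t.+1] slots on
    the stack of time [t]. *)
Definition class_fault (t : nat) (i : 'I_l) : bool :=
  (cls (req t) == i) &&
  (req t \notin take (class_slots t.+1 i) (class_stack (h t) i)).

Definition lag_bound (t : nat) (i : 'I_l) (phi : nat) : Prop := forall tau,
  (count (requested_within sigma t tau) [seq x <- C t | cls x == i] <=
   count (requested_within sigma t tau)
     (take (class_slots t i) (class_stack (h t) i)) + phi)%N.

(* The least valid [phi] is the potential: the largest lead of [C t] over the
   first slots of the stack, over all deadlines, in the number of cached pages
   requested before the deadline. *)
Lemma lag_bound_step t i phi : (t < size sigma)%N -> req t \in C t.+1 ->
  lag_bound t i phi -> exists phi', lag_bound t.+1 i phi' /\
  (class_fault t i + phi' <=
     phi + class_loads t i + (class_slots t i - class_slots t.+1 i))%N.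
Proof.
move=> lt_t req_in lag; set n := class_slots t i; set n' := class_slots t.+1 i.
set S := class_stack (h t) i; set X' := [seq x <- C t.+1 | cls x == i].
(* The lag of [C t.+1] over the first [n'] pages of the old stack: a load adds at most one to the
   left side, a lost slot takes at most one from the right. *)
pose phi1 := (phi + class_loads t i + (n - n'))%N.
have lag1 tau : (count (requested_within sigma t tau) X' <=
    count (requested_within sigma t tau) (take n' S) + phi1)%N.
  have := lag tau; have := count_take_shrink (requested_within sigma t tau) S n' n.
  rewrite !count_filter -/n -/S.
  have := count_fsetD (predI (requested_within sigma t tau) (fun x => cls x == i)) (C t) (C t.+1).
  have : (count (predI (requested_within sigma t tau) (fun x => cls x == i))
      (C t.+1 `\` C t)%fset <= class_loads t i)%N.
    by apply: sub_count => x /= /andP[].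
  rewrite /phi1; move: (n - n')%N (class_loads t i) (count _ (take n S)) (count _ (take n' S)) => d L a b.
  do 4! move: (count _ _) => ?; lia.
have uX : uniq X' by rewrite filter_uniq ?fset_uniq.
have szX : size X' = n' by rewrite size_filter.
have empty tau s : (tau <= t.+1)%N -> count (requested_within sigma t.+1 tau) s = 0%N.
  by move=> le; rewrite (eq_count (a2 := pred0)) ?count_pred0 // => x; apply: requested_within_empty.
have uS : uniq S := class_stack_uniq _ _.
rewrite /class_fault /lag_bound /=; have [clsp|clsNp] /= := eqVneq (cls (req t)) i; last first.
  exists phi1; split=> [tau|]; last by rewrite add0n.
  have [le|lt] := leqP tau t.+1; first by rewrite !empty.
  (* A request to another class changes no deadline set within class [i]. *)
  have same s : {in s, forall x, cls x = i} ->
      count (requested_within sigma t tau) s = count (requested_within sigma t.+1 tau) s.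
    move=> clss; apply: eq_in_count => x /clss clsx.
    rewrite (requested_within_next p0) //; last lia.
    by case: eqVneq clsx => // -> e; rewrite e eqxx in clsNp.
  rewrite -!same ?lag1 // => x; last by rewrite mem_filter => /andP[/eqP].
  by move/mem_take/class_stack_cls.
have pX : req t \in X' by rewrite mem_filter clsp eqxx.
have n'_gt0 : (0 < n')%N by rewrite -szX; case: (X') pX.
rewrite -/n' -/S; set p := req t in clsp pX *.
set S' := stack_update _ S p.
have Dnext tau s : uniq s -> (t.+1 < tau)%N -> count (requested_within sigma t tau) s =
    (count (requested_within sigma t.+1 tau) s +
       ((p \in s) && ~~ requested_within sigma t.+1 tau p))%N.
  move=> us lt; rewrite -count_pred1U //; apply: eq_count => x.
  by rewrite (requested_within_next p0) //; lia.
have [hit|miss] /= := boolP (p \in take n' S).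
  exists phi1; split=> // tau.
  have [le|lt] := leqP tau t.+1; first by rewrite !empty.
  have := lag1 tau; rewrite !Dnext ?take_uniq // pX hit /=.
  have /permP -> : perm_eq (take n' S') (take n' S); last by rewrite addnAC leq_add2r.
  by apply: uniq_perm; rewrite ?take_uniq ?stack_update_uniq // ; apply: take_stack_update_hit.
(* At the deadline [t.+1] only [p] counts: [C t.+1] has it and the prefix lacks it. *)
have phi1_gt0 : (0 < phi1)%N.
  have := lag1 t.+1.
  have D1 s : count (requested_within sigma t t.+1) s = count_mem p s.
    by apply: eq_count => x; rewrite (requested_within_next p0) // requested_within_empty ?orbF.
  rewrite !D1 (count_memPn miss) add0n; apply: leq_trans.
  by rewrite -has_count has_pred1.
exists phi1.-1; split; last by rewrite /phi1 in phi1_gt0 *; lia.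
move=> tau; rewrite -/X'; have [le|lt] := leqP tau t.+1; first by rewrite !empty.
have := lag1 tau; rewrite !Dnext ?take_uniq // pX (negPf miss) /= addn0.
set D := requested_within sigma t.+1 tau.
(* If the prefix gains [p] and loses no page of [D], the lag falls by one. *)
have plain : count D (take n' S') = (count D (take n' S) + D p)%N ->
    (count D X' + ~~ D p <= count D (take n' S) + phi1)%N ->
    (count D X' <= count D (take n' S') + phi1.-1)%N.
  by move=> ->; case: (D p) => /=; lia.
have [lt_S|le_S] := ltnP (size S) n'.
  apply: plain; have le_S := ltnW lt_S.
  have pNS : p \notin S by rewrite take_oversize in miss.
  have permS : perm_eq S' (p :: S) := stack_update_perm_new _ pNS.
  rewrite (take_oversize le_S) take_oversize ?(perm_size permS) //.
  by rewrite (permP permS) /= addnC.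
have [|q [qin /permP perm Dq]] := take_stack_update_miss (wimp_rel cls sigma t.+1) uS _ miss.
  by rewrite n'_gt0.
have := perm D; rewrite /= -/S'; have [Dq1|] := boolP (D q); last first.
  by move=> _; rewrite add0n => e; apply: plain; rewrite e addnC.
have clsS x : x \in take n' S -> cls x = i by move/mem_take/class_stack_cls.
(* If the evicted [q] meets the deadline, so does the whole prefix: the new prefix then has
   [n' - 1 + D p] pages in [D], and [X'], which has [n'] pages with [p] among them, has no more. *)
have : all D (take n' S).
  apply: Dq Dq1 => x y xin yin; rewrite /wimp_rel (clsS _ xin) (clsS _ yin) eqxx /=.
    exact: requested_within_earlier.
  exact: requested_within_not_earlier.
rewrite all_count => /eqP ->; rewrite size_takel // => e _.
have : (count D X' + ~~ D p <= n')%N.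
  have := count_pred1U p D uX; rewrite pX /= => <-.
  by rewrite -szX count_size.
by move: e; case: (D p) => /=; lia.
Qed.

(** The potential is [phi] plus the slots of the class. A lost slot is paid by the fall of the
    second term, and a load raises each term by at most one, hence the factor 2. *)
Lemma class_faults_le k i : paging_feasible k sigma C ->
  (\sum_(t < size sigma) class_fault t i <=
     2 * \sum_(t < size sigma) class_loads t i)%N.
Proof.
move=> [C0 feas].
suff main T : (T <= size sigma)%N -> exists phi, lag_bound T i phi /\
    (\sum_(t < T) class_fault t i + phi + class_slots T i <=
     2 * \sum_(t < T) class_loads t i)%N.
  by have [phi [_]] := main _ (leqnn _); lia.
elim: T => [_|T IHT ltT].
  by exists 0%N; split=> [tau|]; rewrite ?big_ord0 /class_slots C0.
have [phi [lag le_phi]] := IHT (ltnW ltT).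
have reqin : req T \in C T.+1.
  by have [] := feas (Ordinal ltT); rewrite (tnth_nth p0).
have [phi' [lag' le_phi']] := lag_bound_step ltT reqin lag.
exists phi'; split=> //; rewrite !big_ord_recr /=.
have := count_fsetD (fun x => cls x == i) (C T) (C T.+1).
rewrite -/(class_loads T i) -/(class_slots _ i) -/(class_slots _ i).
move: le_phi le_phi'; rewrite !mulnDr.
move: (nat_of_bool _) (count _ _) (class_slots _ _) (class_slots _ _) => f e n' n.
move: (class_loads T i) (2 * _)%N (\sum_(t < T) _)%N => L LL F; lia.
Qed.
End Stacks.

Local Open Scope ring_scope.

(** * Balanced integral roundings *)

Definition near_const (M : nat) (f : nat -> int) : Prop :=
  forall j j', (j < M)%N -> (j' < M)%N -> f j <= f j' + 1.

(** An entry below [c] would force all others to be at most [c], and the sum would fall short of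
    [c * M]. *)
Lemma near_const_ge M f c : near_const M f -> c * M%:Z <= \sum_(j < M) f j ->
  forall j, (j < M)%N -> c <= f j.
Proof.
move=> nf le_sum j ltj; rewrite leNgt; apply/negP => lt_fc.
have le1 (i : 'I_M) : f i <= c by have := nf i j (ltn_ord i) ltj; lia.
have : \sum_(i < M) (c - f i) <= 0.
  by rewrite sumrB sumr_const card_ord -mulr_natr natz subr_le0.
rewrite leNgt => /negP; apply.
rewrite (bigD1 (Ordinal ltj)) //= ltr_wpDr ?subr_gt0 //.
by apply: sumr_ge0 => i _; rewrite subr_ge0.
Qed.

Lemma near_constN M f : near_const M f -> near_const M (fun j => - f j).
Proof. by move=> nf j j' hj hj'; have := nf j' j hj' hj; lia. Qed.

Lemma near_const_le M f c : near_const M f -> \sum_(j < M) f j <= c * M%:Z ->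
  forall j, (j < M)%N -> f j <= c.
Proof.
move=> nf le_sum j ltj; rewrite -lerN2.
apply: (near_const_ge (near_constN nf)) ltj.
by rewrite sumrN mulNr lerN2.
Qed.

Section Rounding.
Variables (l : nat) (lev : 'I_l -> nat).
Implicit Types n : nat -> 'I_l -> int.

Definition level_weight (i : 'I_l) : int := (2 ^ lev i)%N%:Z.
Local Notation W := level_weight.

Definition heavy_sum n (s j : nat) : int := \sum_(i | (s <= lev i)%N) n j i.

Definition balanced M n : Prop :=
  (forall i, near_const M (n^~ i)) /\ (forall s, near_const M (heavy_sum n s)).

Definition column_total M n (i : 'I_l) : int := \sum_(j < M) n j i.

Definition change_cost M n n' : int :=
  \sum_(j < M) \sum_i W i * `|n' j i - n j i|.

Lemma change_cost_trans M n1 n2 n3 :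
  change_cost M n1 n3 <= change_cost M n1 n2 + change_cost M n2 n3.
Proof.
rewrite -big_split; apply: ler_sum => j _; rewrite -big_split.
apply: ler_sum => i _ /=; rewrite -mulrDr ler_wpM2l //; lia.
Qed.

Definition bump_at (n : nat -> 'I_l -> int) (r : nat) (c : 'I_l) (d : int) :=
  fun j i => n j i + (if (j == r) && (i == c) then d else 0).

Lemma heavy_sum_bump n r c d s j : heavy_sum (bump_at n r c d) s j =
  heavy_sum n s j + (if (j == r) && (s <= lev c)%N then d else 0).
Proof.
rewrite /heavy_sum big_split /=; congr (_ + _).
have [_|_] /= := eqVneq j r; last by rewrite big1.
rewrite -big_mkcondr /=; case: ifP => hs.
  by rewrite (big_pred1 c) // => i /=; case: eqVneq => [->|]; rewrite ?hs ?andbT ?andbF.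
by rewrite big1 // => i /andP[h /eqP e]; rewrite e hs in h.
Qed.

Lemma column_total_bump M n r c d i : (r < M)%N ->
  column_total M (bump_at n r c d) i = column_total M n i + (if i == c then d else 0).
Proof.
move=> hr; rewrite /column_total big_split /=; congr (_ + _).
have [_|_] := eqVneq i c; last by rewrite big1 // => j _; rewrite andbF.
rewrite (bigD1 (Ordinal hr)) //= eqxx big1 ?addr0 // => j.
by rewrite -val_eqE /= => /negPf ->.
Qed.

Lemma change_cost_bump M n r c d : (r < M)%N ->
  change_cost M n (bump_at n r c d) = W c * `|d|.
Proof.
move=> hr; rewrite /change_cost /bump_at.
rewrite (bigD1 (Ordinal hr)) //= [X in _ + X]big1 => [|j]; last first.
  rewrite -val_eqE /= => /negPf ->; apply: big1 => i _.
  by rewrite addr0 subrr normr0 mulr0.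
rewrite eqxx (bigD1 c) //= eqxx big1 => [|i /negPf ->].
  by rewrite !addr0 addrAC subrr add0r.
by rewrite addr0 subrr normr0 mulr0.
Qed.

Lemma argmin_row M (f : nat -> int) : (0 < M)%N ->
  exists2 r, (r < M)%N & forall j, (j < M)%N -> f r <= f j.
Proof.
case: M => // M _; pose r := [arg min_(r < (ord0 : 'I_M.+1)) f r]%O.
exists r; first exact: ltn_ord.
move=> j hj; rewrite /r; case: arg_minP => // i _ /(_ (Ordinal hj)); exact.
Qed.

(* The bump at column [a] is first made in a row that is minimal there; it
   raises every heavy sum of level <= lev a by one in the row [r].  Going down
   the levels, whenever this makes row [r] too heavy at level [s], a class of
   level exactly [s] is exchanged with a row that was light there, and the
   excess moves to that row. *)
Lemma increment_down M n a : (0 < M)%N -> balanced M n ->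
  forall u, (u <= (lev a).+1)%N -> let s := ((lev a).+1 - u)%N in
  exists n' r, [/\ (r < M)%N,
    (forall i, near_const M (n'^~ i)) /\
    (forall s', (s <= s')%N -> near_const M (heavy_sum n' s')),
    (forall s' j, (s' < s)%N -> (j < M)%N ->
       heavy_sum n' s' j = heavy_sum n s' j + (j == r)%:Z),
    (forall i, column_total M n' i = column_total M n i + (i == a)%:Z) &
    change_cost M n n' + 2 * (2 ^ s)%N%:Z <= 5 * W a].
Proof.
(* The term [2 * 2 ^ s] is the budget for the levels below [s]: an exchange at level [s'] costs
   [2 * 2 ^ s'], and these add up to less. At the start the bump costs [W a] and the budget is
   [4 * W a]. *)
move=> M0 [coln hsn]; elim=> [_|u IHu ltu] /=.
  rewrite subn0; have [r hr minr] := argmin_row (n^~ a) M0.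
  exists (bump_at n r a 1), r; split => //.
  - split=> [i j j' hj hj'|s' hs' j j' hj hj'].
      rewrite /bump_at; have := coln i j j' hj hj'.
      have [->|_] := eqVneq i a; rewrite ?andbF ?andbT; last lia.
      have := minr j' hj'.
      by case: (eqVneq j r) => [->|_]; case: (eqVneq j' r) => [->|_] /=; lia.
    have /negPf hs : ~~ (s' <= lev a)%N by lia.
    by rewrite !heavy_sum_bump hs !andbF !addr0; apply: hsn.
  - move=> s' j hs' hj; rewrite heavy_sum_bump.
    by rewrite -ltnS hs' andbT; case: eqP.
  - by move=> i; rewrite column_total_bump //; case: eqP.
  - by rewrite change_cost_bump // /level_weight expnS; lia.
have [|n' [r [hr [col1 hs1] exc tot cost]]] := IHu; first by lia.
have := erefl ((lev a).+1 - u)%N; set s1 := ((lev a).+1 - u)%N in hs1 exc cost *.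
move=> _; have -> : ((lev a).+1 - u.+1)%N = s1.-1 by lia.
have s1_gt0 : (0 < s1)%N by lia.
case: s1 s1_gt0 hs1 exc cost => // s _ hs1 exc cost /=.

have split_heavy m j : heavy_sum m s j =
    heavy_sum m s.+1 j + \sum_(i | lev i == s) m j i.
  rewrite /heavy_sum (bigID (fun i => lev i == s)) /= addrC; congr (_ + _).
    by apply: eq_bigl => i; rewrite ltn_neqAle eq_sym andbC.
  by apply: eq_bigl => i; case: eqVneq => [->|]; rewrite ?leqnn ?andbF.
have w_s : 2 * (2 ^ s.+1)%N%:Z = 2 * (2 ^ s)%N%:Z + 2 * (2 ^ s)%N%:Z :> int.
  by rewrite expnS; lia.
have w_pos : 0 <= (2 ^ s)%N%:Z by [].
have [/forallP minr|] :=
    boolP [forall j : 'I_M, heavy_sum n s r <= heavy_sum n s j].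
  exists n', r; split => //; [split=> // s' hs'|by move=> s' j hs'; apply: exc; lia|lia].
  have [->|ne_s] := eqVneq s' s; last by apply: hs1; lia.
  move=> j j' hj hj'; rewrite !exc //.
  have := hsn s j j' hj hj'; have := minr (Ordinal hj'); rewrite /=.
  by case: eqVneq => [->|_]; case: eqVneq => [?|_]; lia.
rewrite negb_forall => /existsP[j1]; rewrite -ltNge => lt_j1.
have hj1 := ltn_ord j1; have nj1r : (j1 : nat) != r.
  by apply: contraTneq lt_j1 => ->; rewrite ltxx.

have near1 j : (j < M)%N -> heavy_sum n s j1 <= heavy_sum n s j.
  by move=> hj; have := hsn s r j hr hj; lia.
(* At level [s] row [r] now exceeds row [j1] by at least two, but at level [s.+1] by at most one:
   the difference comes from a class of level exactly [s]. *)
have [c levc lt_c] : exists2 c, lev c = s & n' j1 c < n' r c.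
  have [/existsP[c /andP[/eqP]]|] :=
    boolP [exists c, (lev c == s) && (n' j1 c < n' r c)]; first by exists c.
  rewrite negb_exists => /forallP noc.
  have : \sum_(i | lev i == s) n' r i <= \sum_(i | lev i == s) n' j1 i.
    by apply: ler_sum => i levi; have := noc i; rewrite levi /= -leNgt.
  have := hs1 s.+1 (leqnn _) r j1 hr hj1.
  have := exc s r (ltnSn s) hr; have := exc s j1 (ltnSn s) hj1.
  rewrite !split_heavy eqxx (negPf nj1r); rewrite !split_heavy in lt_j1.
  lia.
(* One unit of [c] goes from row [r] to row [j1]: column totals stay, and the excess in the levels
   below passes to [j1]. *)
exists (bump_at (bump_at n' r c (-1)) j1 c 1), j1; split => //.
- split=> [i j j' hj hj'|s' hs'].
    have := col1 i j j' hj hj'; rewrite /bump_at.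
    have [->|_] := eqVneq i c; rewrite ?andbF ?andbT ?addr0 //.
    have := col1 c r j' hr hj'; have := col1 c j j1 hj hj1.
    have := col1 c r j1 hr hj1.
    by do 4! (case: eqVneq => ? //=); subst; lia.
  have [->|ne_s] := eqVneq s' s.
    move=> j j' hj hj'; rewrite !heavy_sum_bump levc leqnn !andbT !exc //.
    have := near1 j' hj'; have := hsn s j j' hj hj'; have := hsn s j j1 hj hj1.
    by do 4! case: eqVneq => ? //=; subst; lia.
  have /negPf hs : ~~ (s' <= lev c)%N by lia.
  move=> j j' hj hj'; rewrite !heavy_sum_bump hs !andbF !addr0.
  by apply: hs1 => //; lia.
- move=> s' j hs' hj; rewrite !heavy_sum_bump exc //; last lia.
  have -> : (s' <= lev c)%N by lia.
  by rewrite !andbT; do 2! case: eqVneq => ? //=; lia.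
- by move=> i; rewrite !column_total_bump // tot; case: (i == c); lia.
- have Wc : W c = (2 ^ s)%N%:Z by rewrite /level_weight levc.
  have := change_cost_trans M n n' (bump_at (bump_at n' r c (-1)) j1 c 1).
  have := change_cost_trans M n' (bump_at n' r c (-1))
    (bump_at (bump_at n' r c (-1)) j1 c 1).
  rewrite !change_cost_bump // Wc normrN1 normr1; lia.
Qed.

Lemma increment M n a : (0 < M)%N -> balanced M n -> exists n',
  [/\ balanced M n', forall i, column_total M n' i = column_total M n i + (i == a)%:Z
    & change_cost M n n' <= 5 * W a].
Proof.
move=> M0 bal; have [n' [r [_ [col hs] _ tot cost]]] :=
  increment_down M0 bal (leqnn (lev a).+1).
exists n'; split=> //; last lia.
by split=> // s; apply: hs; rewrite subnn.
Qed.

Lemma balancedN M n : balanced M n -> balanced M (fun j i => - n j i).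
Proof.
move=> [col hs]; split=> [i|s]; first exact: near_constN (col i).
have := near_constN (hs s); rewrite /near_const /heavy_sum => H j j' hj hj'.
by rewrite !sumrN; apply: H.
Qed.

Lemma change_costN M n n' :
  change_cost M (fun j i => - n j i) n' = change_cost M n (fun j i => - n' j i).
Proof.
by apply: eq_bigr => j _; apply: eq_bigr => i _; rewrite opprK -opprD normrN.
Qed.

Lemma column_totalN M n i : column_total M (fun j i => - n j i) i = - column_total M n i.
Proof. by rewrite /column_total sumrN. Qed.

(** Negating all entries turns an increment into a decrement and keeps balance and cost. *)
Lemma decrement M n a : (0 < M)%N -> balanced M n -> exists n',
  [/\ balanced M n', forall i, column_total M n' i = column_total M n i - (i == a)%:Z
    & change_cost M n n' <= 5 * W a].
Proof.
move=> M0 /balancedN bal; have [n' [bal' tot cost]] := increment a M0 bal.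
exists (fun j i => - n' j i); split; first exact: balancedN.
  by move=> i; rewrite column_totalN tot column_totalN opprD opprK.
by rewrite -change_costN.
Qed.

(** Induction on the total distance to [m]: a unit step in a column [a] that is off costs at most
    [5 * W a] and lowers the remaining bound by as much. *)
Lemma rebalance M n (m : 'I_l -> int) : (0 < M)%N -> balanced M n -> exists n',
  [/\ balanced M n', forall i, column_total M n' i = m i
    & change_cost M n n' <= 5 * \sum_i W i * `|m i - column_total M n i|].
Proof.
move=> M0; have [D] := ubnP (\sum_i absz (m i - column_total M n i))%N.
elim: D n => // D IHD n ltD bal.
have [/forallP eqm|] := boolP [forall i, m i == column_total M n i].
  exists n; split => [//|i|]; first by rewrite (eqP (eqm i)).
  rewrite /change_cost big1 => [|j _]; last first.
    by apply: big1 => i _; rewrite subrr normr0 mulr0.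
  by apply: mulr_ge0 => //; apply: sumr_ge0 => i _; apply: mulr_ge0.
rewrite negb_forall => /existsP[a ne_a].
have [n1 [e [bal1 tot1 cost1 he]]] : exists n1 (e : int), [/\ balanced M n1,
    forall i, column_total M n1 i = column_total M n i + (if i == a then e else 0),
    change_cost M n n1 <= 5 * W a &
    `|m a - column_total M n a| = `|m a - (column_total M n a + e)| + 1].
  have [lt_m|le_m] := ltP (column_total M n a) (m a).
    have [n1 [? tot1 ?]] := increment a M0 bal.
    by exists n1, 1; split=> // [i|]; [rewrite tot1; case: eqP|lia].
  have [n1 [? tot1 ?]] := decrement a M0 bal.
  exists n1, (-1); split=> // [i|]; first by rewrite tot1; case: eqP.
  by move/eqP: ne_a; lia.
have others i : i != a -> column_total M n1 i = column_total M n i.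
  by move=> /negPf ne; rewrite tot1 ne addr0.
have [||n' [bal' tot' cost']] := IHD n1 => //.
  move: ltD; rewrite (bigD1 a) //= [X in _ -> (X < _)%N](bigD1 a) //=.
  rewrite tot1 eqxx.
  under [X in _ -> (_ + X < _)%N]eq_bigr => i ia do rewrite others //.
  lia.
exists n'; split => //; apply: (le_trans (change_cost_trans M n n1 n')).
move: cost'; rewrite (bigD1 a) //= [X in _ -> _ <= 5 * X](bigD1 a) //=.
rewrite tot1 eqxx.
under eq_bigr => i ia do rewrite others //.
rewrite he (mulrDr (W a)) mulr1; lra.
Qed.
End Rounding.

(** * Row duplication and the fraction of rows missing a page *)

Lemma sum_half (V : nmodType) (f : nat -> V) M :
  \sum_(j < 2 * M) f j./2 = (\sum_(j < M) f j) *+ 2.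
Proof.
elim: M => [|M IHM]; first by rewrite !big_ord0 mul0rn.
rewrite mulnS !add2n !big_ord_recr /= IHM mulrnDl mulr2n -addrA.
by rewrite mul2n uphalf_double doubleK.
Qed.

(** Copying each row [j] to its children [2 j] and [2 j + 1] refines the seed by one digit. *)
Lemma balanced_half l (lev : 'I_l -> nat) M n : balanced lev M n ->
  balanced lev (2 * M) (fun j => n j./2).
Proof.
move=> [col hs]; split=> [i|s] j j' hj hj'; [apply: col|apply: hs]; lia.
Qed.

Lemma ler_sum_subset (T : eqType) (R : numDomainType) (F : T -> R) (s1 s2 : seq T) :
  uniq s1 -> {subset s1 <= s2} -> (forall x, 0 <= F x) ->
  \sum_(x <- s1) F x <= \sum_(x <- s2) F x.
Proof.
move=> u1 sub F0; elim: s1 s2 u1 sub => [|x s1 IHs] s2 /=.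
  by move=> _ _; rewrite big_nil; apply: sumr_ge0.
move=> /andP[xNs us] sub; have xs2 : x \in s2 by rewrite sub ?mem_head.
rewrite big_cons (perm_big _ (perm_to_rem xs2)) big_cons lerD2l; apply: IHs => // y ys.
have := sub y; rewrite inE ys orbT => /(_ isT).
rewrite (perm_mem (perm_to_rem xs2)) inE => /orP[/eqP yx|//].
by rewrite -yx ys in xNs.
Qed.

Section Deficit.
Variables (R : realType) (P : choiceType).

(* The mass by which an allocation of [y] slots misses the page [p], the one
   at depth [index p S] of the stack [S]. *)
Definition deficit (y : R) (S : seq P) (p : P) : R :=
  if p \in S then Num.max 0 (Num.min 1 ((index p S).+1%:R - y)) else 1.

Lemma deficit_ge0 y S p : 0 <= deficit y S p.
Proof. by rewrite /deficit; case: ifP; rewrite // le_max lexx. Qed.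

Lemma deficit_nincr y y' S p : y <= y' -> deficit y' S p <= deficit y S p.
Proof.
move=> le_y; rewrite /deficit; case: ifP => // _.
by apply: le_max2 => //; apply: le_min2 => //; rewrite lerD2l lerN2.
Qed.

Lemma deficit_lipschitz y y' S p : deficit y' S p <= deficit y S p + `|y' - y|.
Proof.
rewrite /deficit; case: ifP => _; last by rewrite lerDl.
have := ler_norm (y - y'); rewrite distrC.
have := normr_ge0 (y' - y); move: (`|_|) => d; move: (_.+1%:R) => a.
by rewrite /Num.max /Num.min; do ! case: ifP; lra.
Qed.

Lemma deficit_nat (n : nat) S p : p \in take n S -> deficit n%:R S p = 0.
Proof.
move=> pin; rewrite /deficit (mem_take pin).
have : (index p S < n)%N by rewrite -in_take ?(mem_take pin).
rewrite -(ler_nat R) => le; apply/max_idPl; rewrite ge_min subr_le0 le.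
by rewrite orbT.
Qed.

Lemma deficit_le1 y S p : deficit y S p <= 1.
Proof. by rewrite /deficit; case: ifP => // _; rewrite ge_max ler01 ge_min lexx. Qed.

(** Let [a] be the depth of [p]. Entries within one of each other all reach [a], or none does, or
    they take only the values [a - 1] and [a]; in the last case exactly [M] times ([a] minus the
    average) of them fall short. *)
Lemma sum_miss_le_deficit M (f : nat -> int) (S : seq P) p : (0 < M)%N ->
  near_const M f -> (forall j, (j < M)%N -> 0 <= f j) ->
  \sum_(j < M) (p \notin take `|f j| S)%:R <=
    M%:R * deficit ((\sum_(j < M) f j)%:~R / M%:R) S p.
Proof.
move=> M0 nf f0; have M0' : 0 < M%:R :> R by rewrite ltr0n.
rewrite /deficit; case: ifP => [pS|pNS]; last first.
  rewrite mulr1 -[X in _ <= X%:R](card_ord M) -sumr_const.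
  by apply: ler_sum => j _; rewrite lern1 leq_b1.
set a := (index p S).+1.
have aM : (a%:R - 1) * M%:R = ((a%:Z - 1) * M%:Z)%:~R :> R.
  by rewrite rmorphM rmorphB.
have missE j : (j < M)%N -> (p \notin take `|f j| S) = (f j < a%:Z).
  move=> /f0; rewrite in_take // /a; lia.
have [/existsP[j0 le_a]|] := boolP [exists j : 'I_M, a%:Z <= f j]; last first.
  rewrite negb_exists => /forallP lt_a.
  have lt_a' j : (j < M)%N -> f j <= a%:Z - 1.
    by move=> hj; have := lt_a (Ordinal hj); rewrite /=; lia.
  have -> : Num.min 1 (a%:R - (\sum_(j < M) f j)%:~R / M%:R) = 1 :> R.
    apply/min_idPl; rewrite lerBrDr addrC -lerBrDr ler_pdivrMr //.
    have : \sum_(j < M) f j <= \sum_(j < M) (a%:Z - 1).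
      by apply: ler_sum => j _; apply: lt_a'.
    by rewrite aM ler_int sumr_const card_ord -mulr_natr natz.
  have -> : Num.max 0 1 = 1 :> R by apply/max_idPr.
  rewrite mulr1 -[X in _ <= X%:R](card_ord M) -sumr_const.
  by apply: ler_sum => j _; rewrite lern1 leq_b1.
have [/existsP[j1 lt_a]|] := boolP [exists j : 'I_M, f j < a%:Z]; last first.
  rewrite negb_exists => /forallP ge_a.
  rewrite big1 ?mulr_ge0 ?le_max ?lexx ?ler0n // => j _.
  by rewrite missE // (negPf (ge_a j)).
have -> : \sum_(j < M) (p \notin take `|f j| S)%:R =
    M%:R * (a%:R - (\sum_(j < M) f j)%:~R / M%:R) :> R.
  rewrite mulrBr mulrCA divff ?gt_eqF // mulr1 mulrC mulr_natr.
  rewrite -[X in _ *+ X](card_ord M) -sumr_const rmorph_sum -sumrB.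
  apply: eq_bigr => j _ /=; rewrite missE //.
  have := nf j j1 (ltn_ord _) (ltn_ord _); have := nf j0 j (ltn_ord _) (ltn_ord _).
  move=> h1 h2; have [lt|le] := ltP (f j) a.
    have e : f j = a%:Z - 1 by lia.
    have -> : (f j)%:~R = a%:R - 1 :> R by rewrite e rmorphB.
    by rewrite opprB addrC subrK.
  have e : f j = a%:Z by lia.
  have -> : (f j)%:~R = a%:R :> R by rewrite e.
  by rewrite subrr.
rewrite ler_pM2l // le_max; apply/orP; right; rewrite le_min lexx andbT.
rewrite lerBlDr -lerBlDl ler_pdivlMr //.
have : \sum_(j < M) (a%:Z - 1) <= \sum_(j < M) f j.
  by apply: ler_sum => j _; have := nf j0 j (ltn_ord _) (ltn_ord _); lia.
by rewrite aM ler_int sumr_const card_ord -mulr_natr natz.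
Qed.
End Deficit.

(** * The online algorithm *)

Lemma sa_valid_seq_rcons (R : realType) l (rs : seq (sa_request R l)) q :
  sa_valid_seq rs -> sa_valid_request q -> sa_valid_seq (rcons rs q).
Proof.
move=> vrs vq t; rewrite (tnth_nth q) /= nth_rcons.
case: ltnP => [lt|_]; last by case: ifP.
by have := vrs (Ordinal lt); rewrite (tnth_nth q).
Qed.

Section Algorithm.
Variables (R : realType) (P : choiceType) (l k : nat) (cls : P -> 'I_l).
Variables (wc : 'I_l -> R) (A : sa_alg R l) (i0 : 'I_l).
Hypotheses (k_gt0 : (0 < k)%N) (wc_gt0 : forall i, 0 < wc i).
Hypotheses (wc_min : forall i, wc i0 <= wc i) (A_valid : sa_alg_valid A).

Local Notation history := (history P).
Local Notation stack := (class_stack cls).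
Implicit Types (h : history) (p : P) (i : 'I_l) (j : nat).

(* The requested page must be in the cache, so its class needs a full slot:
   hence the infinite cost below one slot. *)
Definition request_cost (S : seq P) p : R -> \bar R := fun x =>
  if k%:R * x < 1 then +oo%E else (wc (cls p) * deficit (k%:R * x) S p)%:E.

Fixpoint requests h : seq (sa_request R l) :=
  match h with
  | [::] => [::]
  | e :: h' => rcons (requests h')
      (SARequest (cls e.1) (request_cost (stack h' (cls e.1)) e.1))
  end.

Lemma size_requests h : size (requests h) = size h.
Proof. by elim: h => //= e h IHh; rewrite size_rcons IHh. Qed.

Lemma request_cost_valid S p i : sa_valid_request (SARequest i (request_cost S p)).
Proof.
split=> [x _|x y _ le_xy _] /=; rewrite /request_cost.
  by case: ifP => // _; rewrite lee_fin mulr_ge0 ?deficit_ge0 // ltW.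
have le_k : k%:R * x <= k%:R * y by rewrite ler_wpM2l.
case: ifP => [lt_y|_].
  by rewrite (le_lt_trans le_k lt_y).
case: ifP => _; first by rewrite leey.
by rewrite lee_fin ler_wpM2l ?deficit_nincr // ltW.
Qed.

Lemma requests_valid h : sa_valid_seq (requests h).
Proof.
elim: h => [[]//|e h IHh] /=.
by apply: sa_valid_seq_rcons => [//|]; apply: request_cost_valid.
Qed.
Arguments requests_valid : clear implicits.

Definition alloc_slots h i : R := k%:R * A (requests h) i.

Lemma slots_ge0 h i : 0 <= alloc_slots h i.
Proof.
by have [/(_ i)/andP[? _] _] := A_valid (requests_valid h); rewrite mulr_ge0.
Qed.

Lemma sum_slots h : \sum_i alloc_slots h i = k%:R.
Proof.
by have [_ e] := A_valid (requests_valid h); rewrite -mulr_sumr e mulr1.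
Qed.

Lemma slots_le h i : alloc_slots h i <= k%:R.
Proof.
rewrite -(sum_slots h) (bigD1 i) //= lerDl; apply: sumr_ge0 => c _.
exact: slots_ge0.
Qed.

(** The prescribed column totals over [2 ^ size h] rows. The empty history gets 0 because the caches
    start empty. *)
Definition grid h i : int :=
  if h is [::] then 0 else (Num.truncn (2 ^+ size h * alloc_slots h i))%:Z.

Lemma grid_ge0 h i : 0 <= grid h i. Proof. by case: h. Qed.

Lemma two_pow_gt0 n : 0 < 2 ^+ n :> R. Proof. exact: exprn_gt0. Qed.

Lemma grid_le h i : (grid h i)%:~R <= 2 ^+ size h * alloc_slots h i.
Proof.
have ge0 : 0 <= 2 ^+ size h * alloc_slots h i.
  by apply: mulr_ge0; [apply: exprn_ge0|apply: slots_ge0].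
by case: h ge0 => //= e h ge0; have /andP[] := truncn_itv ge0.
Qed.

(** Truncation errs by at most one unit; the factor [k] also covers the empty history, where [grid]
    is 0 while up to [k] slots are allotted. *)
Lemma grid_err h i :
  `|(grid h i)%:~R / 2 ^+ size h - alloc_slots h i| <= k%:R / 2 ^+ size h.
Proof.
rewrite ler_norml; apply/andP; split; last first.
  apply: (@le_trans _ _ 0); last first.
    by apply: divr_ge0; [apply: ler0n|apply/ltW/two_pow_gt0].
  by rewrite subr_le0 ler_pdivrMr ?two_pow_gt0 // mulrC grid_le.
rewrite lerBrDr addrC lerBlDr -mulrDl ler_pdivlMr ?two_pow_gt0 //.
have ge0 : 0 <= 2 ^+ size h * alloc_slots h i.
  by apply: mulr_ge0; [apply: exprn_ge0|apply: slots_ge0].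
have k1 : 1 <= k%:R :> R by rewrite ler1n.
case: h ge0 => [|e h] ge0 /=; first by rewrite expr0 mulr1 add0r slots_le.
have /andP[_ /ltW] := truncn_itv ge0; rewrite mulrC => /le_trans; apply.
by rewrite -natr1 lerD2l.
Qed.

Definition level i : nat := trunc_log 2 (Num.truncn (wc i / wc i0)).

Lemma level_weight_bounds i : let w := wc i0 * (level_weight level i)%:~R in
  w <= wc i <= 2 * w.
Proof.
set u := Num.truncn (wc i / wc i0).
have ratio : 1 <= wc i / wc i0 by rewrite ler_pdivlMr // mul1r.
have /andP[le_u lt_u] := truncn_itv (le_trans ler01 ratio).
have u_gt0 : (0 < u)%N by rewrite truncn_gt0.
have /andP[le_2 lt_2] := trunc_log_bounds (isT : (1 < 2)%N) u_gt0.
rewrite /= /level_weight /level -/u.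
have -> : (2 ^ trunc_log 2 u)%N%:Z%:~R = (2 ^ trunc_log 2 u)%:R :> R by [].
have e : wc i = wc i / wc i0 * wc i0 by rewrite divfK // gt_eqF.
rewrite ![wc i0 * _]mulrC mulrA {1 2}e !ler_pM2r //.
apply/andP; split.
  by apply: le_trans le_u; rewrite ler_nat.
apply: (le_trans (ltW lt_u)).
by rewrite -natrM ler_nat -expnS.
Qed.

(** A chosen witness of [rebalance]. The default [n] is never reached for balanced [n] and positive
    [M]. *)
Definition rebalanced M n (m : 'I_l -> int) : nat -> 'I_l -> int :=
  match pselect (exists n', [/\ balanced level M n',
      forall i, column_total M n' i = m i
    & change_cost level M n n' <=
      5 * \sum_i level_weight level i * `|m i - column_total M n i|]) with
  | left ex => projT1 (cid ex)
  | right _ => n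
  end.

(* Row [j < 2 ^ size h] is the integral allocation used when the first
   [size h] binary digits of the random seed encode [j]; each step appends one
   digit, so that row [j] continues row [j./2]. *)
Fixpoint rounded h : nat -> 'I_l -> int :=
  match h with
  | [::] => fun _ _ => 0
  | e :: h' => rebalanced (2 ^ size h) (fun j => rounded h' j./2) (grid h)
  end.

Lemma rounded_total h :
  balanced level (2 ^ size h) (rounded h) /\
  forall i, column_total (2 ^ size h) (rounded h) i = grid h i.
Proof.
elim: h => [|e h [bal tot]] /=.
  split=> [|i]; last by rewrite /column_total big1.
  by split=> [i|s] j j' _ _; rewrite /heavy_sum ?big1.
rewrite /rebalanced; case: pselect => [ex|nex]; first by case: (cid ex) => n' [].
case: nex; apply: rebalance; first by rewrite expn_gt0.
by rewrite expnS; apply: balanced_half.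
Qed.

Lemma rounded_change_cost e h :
  change_cost level (2 ^ (size h).+1) (fun j => rounded h j./2) (rounded (e :: h)) <=
  5 * \sum_i level_weight level i * `|grid (e :: h) i - 2 * grid h i|.
Proof.
have [bal tot] := rounded_total h.
have tot2 i : column_total (2 ^ (size h).+1) (fun j => rounded h j./2) i = 2 * grid h i.
  by rewrite /column_total expnS (sum_half (fun j => rounded h j i)) -tot mulr2n mulrDl !mul1r.
have bal2 : balanced level (2 ^ (size h).+1) (fun j => rounded h j./2).
  by rewrite expnS; apply: balanced_half.
under eq_bigr => i _ do rewrite -tot2.
rewrite [rounded (e :: h)]/= /rebalanced; case: pselect => [ex|nex].
  by case: (cid ex) => n' [].
by case: nex; apply: rebalance => //; rewrite expn_gt0.
Qed.

Lemma rounded_ge0 h j i : (j < 2 ^ size h)%N -> 0 <= rounded h j i.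
Proof.
have [[col _] tot] := rounded_total h.
by apply: (near_const_ge (col i)); rewrite mul0r [X in _ <= X]tot grid_ge0.
Qed.

(** Truncating a number that is at least the integer [2 ^ t] leaves it at least [2 ^ t], so the
    column average stays at least 1, and balance carries this to every row. *)
Lemma rounded_ge1 e h j i : 1 <= alloc_slots (e :: h) i ->
  (j < 2 ^ (size h).+1)%N -> 1 <= rounded (e :: h) j i.
Proof.
move=> ge1; have [[col _] tot] := rounded_total (e :: h).
apply: (near_const_ge (col i)); rewrite mul1r [X in _ <= X]tot /=.
rewrite lez_nat truncn_ge_nat; last first.
  by apply: mulr_ge0; [apply: exprn_ge0|apply: slots_ge0].
by rewrite natrX ler_peMr // exprn_ge0.
Qed.

Arguments rounded : simpl never.
Arguments grid : simpl never.

(** The heavy sum at level 0 is the whole row sum, so balance applies to it; its average is at most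
    [k] because [grid] rounds down. *)
Lemma sum_rounded_le h j : (j < 2 ^ size h)%N -> \sum_i rounded h j i <= k%:Z.
Proof.
have [[_ /(_ 0%N) hs] tot] := rounded_total h.
apply: (near_const_le hs); rewrite /heavy_sum exchange_big /=.
rewrite (eq_bigr (grid h)) => [|i _]; last exact: tot.
rewrite -(ler_int R) rmorph_sum /=.
apply: (@le_trans _ _ (\sum_i 2 ^+ size h * alloc_slots h i)).
  by apply: ler_sum => i _; apply: grid_le.
rewrite -mulr_sumr sum_slots rmorphM /= mulrC.
by rewrite -!pmulrn natrX.
Qed.

Definition row_cache h j : {fset P} := [fset x in
  flatten [seq take `|rounded h j i| (stack h i) | i <- enum 'I_l]]%fset.

Lemma mem_row_cache h j x : (x \in row_cache h j) =
  (x \in take `|rounded h j (cls x)| (stack h (cls x))).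
Proof.
rewrite in_fset_; apply/flatten_mapP/idP => [[i _ xin]|xin].
  by have clsx := class_stack_cls (mem_take xin); rewrite clsx.
by exists (cls x); rewrite ?mem_enum.
Qed.

Lemma card_row_cache h j : (j < 2 ^ size h)%N -> (#|` row_cache h j| <= k)%N.
Proof.
move=> hj; rewrite card_fseq; apply: (leq_trans (size_undup _)).
rewrite size_flatten /shape -map_comp sumnE big_map big_enum /=.
rewrite -lez_nat; apply: le_trans (sum_rounded_le hj).
rewrite -natz rmorph_sum /=; apply: ler_sum => i _; rewrite natz /=.
have := rounded_ge0 i hj.
have : (size (take `|rounded h j i| (stack h i)) <= `|rounded h j i|)%N.
  by rewrite size_take_min geq_minl.
by rewrite -lez_nat => le_s ge0; apply: (le_trans le_s); rewrite gez0_abs.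
Qed.

Lemma row_cache_top e h j : 1 <= alloc_slots (e :: h) (cls e.1) ->
  (j < 2 ^ (size h).+1)%N -> e.1 \in row_cache (e :: h) j.
Proof.
move=> ge1 hj; rewrite mem_row_cache [stack _ _]/= eqxx.
apply: mem_take_stack_update_top; rewrite absz_gt0 gt_eqF //.
exact: lt_le_trans ltr01 (rounded_ge1 ge1 hj).
Qed.

Lemma row_cache_nil j : row_cache [::] j = fset0.
Proof. by apply/fsetP => x; rewrite mem_row_cache in_fset0. Qed.

Definition row_loads e h j : R :=
  \sum_(x <- (row_cache (e :: h) j `\` row_cache h j./2)%fset) wc (cls x).

Definition row_fault e h j : bool :=
  e.1 \notin take `|rounded (e :: h) j (cls e.1)| (stack h (cls e.1)).

Lemma row_loads_le e h j : (j < 2 ^ (size h).+1)%N -> row_loads e h j <=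
  \sum_i wc i * `|rounded (e :: h) j i - rounded h j./2 i|%:~R
  + wc (cls e.1) * (row_fault e h j)%:R.
Proof.
move=> hj; have hj2 : (j./2 < 2 ^ size h)%N by move: hj; rewrite expnS; lia.
pose n' i := `|rounded (e :: h) j i|%N; pose n i := `|rounded h j./2 i|%N.
(* A loaded page is the request itself or lies in a part of the old stack that a longer prefix
   uncovers, since no other page rises. *)
pose s := nseq (row_fault e h j) e.1 ++
  flatten [seq drop (n i) (take (n' i) (stack h i)) | i <- enum 'I_l].
apply: (@le_trans _ _ (\sum_(x <- s) wc (cls x))).
  apply: ler_sum_subset => [|x|x]; [exact: fset_uniq| |exact: ltW].
  rewrite in_fsetD !mem_row_cache -/(n' _) -/(n _) mem_cat => /andP[xNn xn'].
  have [xs|xNs] := boolP (x \in take (n' (cls x)) (stack h (cls x))).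
    apply/orP; right; apply/flatten_mapP; exists (cls x); rewrite ?mem_enum //.
    have : x \in take (n (cls x)) (take (n' (cls x)) (stack h (cls x))) ++
        drop (n (cls x)) (take (n' (cls x)) (stack h (cls x))) by rewrite cat_take_drop.
    rewrite mem_cat => /orP[|//]; rewrite -take_min minnC take_min => /mem_take.
    by rewrite (negPf xNn).
  have xe : x = e.1.
    move: xn'; rewrite /=; case: ifP => [_|_ xin]; last by rewrite xin in xNs.
    move/(take_stack_update_sub (class_stack_uniq _ _ _)).
    by rewrite inE (negPf xNs) orbF => /eqP.
  by rewrite /row_fault -xe xNs mem_nseq /= eqxx.
rewrite big_cat addrC lerD //.
  by rewrite big_nseq /=; case: row_fault; rewrite /= ?mulr1 ?mulr0 ?addr0.
rewrite big_flatten big_map big_enum /=; apply: ler_sum => i _.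
rewrite (eq_big_seq (fun=> wc i)) => [|x /mem_drop/mem_take/class_stack_cls -> //].
rewrite big_const_seq count_predT iter_addr_0 -mulr_natr ler_pM2l //.
rewrite pmulrn ler_int.
have := @rounded_ge0 (e :: h) j i hj; have := rounded_ge0 i hj2.
rewrite size_drop size_take_min /n /n'.
move: (rounded (e :: h) j i) (rounded h j./2 i) (size _) => a b c; lia.
Qed.

Lemma sum_row_loads_le e h (M := 2 ^+ (size h).+1 : R) :
  \sum_(j < 2 ^ (size h).+1) row_loads e h j <=
  M * (10 * \sum_i wc i *
         `|(grid (e :: h) i)%:~R / M - (grid h i)%:~R / 2 ^+ size h|
       + wc (cls e.1) *
         deficit ((grid (e :: h) (cls e.1))%:~R / M) (stack h (cls e.1)) e.1).
Proof.
have M_gt0 : 0 < M by apply: two_pow_gt0.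
have ME : (2 ^ (size h).+1)%:R = M :> R by rewrite natrX.
apply: (@le_trans _ _ (\sum_(j < 2 ^ (size h).+1)
  (\sum_i wc i * `|rounded (e :: h) j i - rounded h j./2 i|%:~R
   + wc (cls e.1) * (row_fault e h j)%:R))).
  by apply: ler_sum => j _; apply: row_loads_le.
rewrite big_split mulrDr lerD //=; last first.
  rewrite -mulr_sumr mulrCA ler_pM2l //.
  have [[col _] tot] := rounded_total (e :: h).
  have := @sum_miss_le_deficit R P _ _ (stack h (cls e.1)) e.1 _ (col (cls e.1)) _.
  rewrite [X in (X%:~R / _)]tot ME; apply; first by rewrite expn_gt0.
  by move=> j hj; apply: rounded_ge0.
set w := wc i0; have w_gt0 : 0 < w by apply: wc_gt0.
(* Weights are rounded to levels here and back at the end, losing a factor 2; with the 5 of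
   [rebalance] this makes 10. *)
apply: (@le_trans _ _ (2 * w * (change_cost level (2 ^ (size h).+1)
    (fun j => rounded h j./2) (rounded (e :: h)))%:~R)).
  rewrite /change_cost rmorph_sum mulr_sumr; apply: ler_sum => j _ /=.
  rewrite rmorph_sum mulr_sumr; apply: ler_sum => i _ /=.
  rewrite rmorphM mulrA ler_wpM2r ?ler0z //.
  by rewrite -mulrA; have /andP[] := level_weight_bounds i.
apply: (@le_trans _ _ (2 * w * (5 *
    \sum_i level_weight level i * `|grid (e :: h) i - 2 * grid h i|)%:~R)).
  by rewrite ler_pM2l ?mulr_gt0 // ler_int rounded_change_cost.
rewrite rmorphM rmorph_sum /= mulrA !mulr_sumr.
apply: ler_sum => i _; rewrite rmorphM /=.
have -> : `|(grid (e :: h) i)%:~R / M - (grid h i)%:~R / 2 ^+ size h| =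
    `|grid (e :: h) i - 2 * grid h i|%:~R / M :> R.
  rewrite -[M in RHS]gtr0_norm // -normfV intr_norm -normrM; congr (`|_|).
  rewrite rmorphB rmorphM /= mulrBl; congr (_ - _).
  by rewrite /M exprS invfM mulrACA divff ?mul1r.
have /andP[le_w _] := level_weight_bounds i.
have := ler_wpM2r (_ : 0 <= `|grid (e :: h) i - 2 * grid h i|%:~R :> R) le_w.
rewrite ler0z => /(_ isT); rewrite -/w; move: (`|_|%:~R) => d le_d.
have -> : M * 10 * (wc i * (d / M)) = 10 * (wc i * d).
  by field; rewrite gt_eqF.
lra.
Qed.
End Algorithm.

(** * Soft cost and offline cost *)

Section Recovery.
Variables (P : choiceType) (l : nat) (cls : P -> 'I_l).

(* The next requests known from the prefix come before all later ones, so the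
   order information at a past time [s] can be computed from the current one. *)
Definition past_rel (pre : seq P) (r : rel P) (s : nat) : rel P := fun x y =>
  let d := drop s pre in
  (cls x == cls y) &&
  (if x \in d then (y \in d) ==> (index x d < index y d)%N
   else (y \notin d) && r x y).

Lemma past_relE (sigma : seq P) s t : (s <= t)%N ->
  past_rel (take t sigma) (wimp_rel cls sigma t) s = wimp_rel cls sigma s.
Proof.
move=> le_st; apply/funext => x; apply/funext => y; rewrite /past_rel /wimp_rel.
case: eqP => //= _; rewrite /req_earlier /next_req.
have -> : drop s sigma = drop s (take t sigma) ++ drop t sigma.
  have [le_t|/ltnW le_t] := leqP t (size sigma).
    rewrite -{1}(cat_take_drop t sigma) drop_cat size_takel //.
    case: ltnP => // le_ts; rewrite (_ : s = t); last lia.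
    by rewrite subnn drop0 (@drop_oversize _ t (take t sigma)) ?size_takel.
  by rewrite (take_oversize le_t) (drop_oversize le_t) cats0.
set d := drop s _; rewrite !mem_cat !index_cat.
have [xd|xd] := boolP (x \in d); have [yd|yd] //= := boolP (y \in d).
- case: ifP => //= _; have : (index x d < size d)%N by rewrite index_mem.
  lia.
- case: ifP => //= _; have : (index y d < size d)%N by rewrite index_mem.
  lia.
- by case: ifP => //=; case: ifP => //= _ _; rewrite ltn_add2l.
Qed.

Lemma eq_history_of p0 (s1 s2 : seq P) (r1 r2 : nat -> rel P) t :
  (forall s, (s < t)%N -> nth p0 s1 s = nth p0 s2 s) ->
  (forall s, (s <= t)%N -> r1 s = r2 s) ->
  history_of p0 s1 r1 t = history_of p0 s2 r2 t.
Proof.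
elim: t => //= t IHt eq_s eq_r; rewrite eq_s // eq_r // IHt // => s lt.
  by apply: eq_s; apply: ltnW.
by apply: eq_r; apply: ltnW.
Qed.

Lemma size_history_of p0 (s : seq P) (r : nat -> rel P) t :
  size (history_of p0 s r t) = t.
Proof. by elim: t => //= t ->. Qed.

(** This is what makes the algorithm myopic: the whole history is rebuilt from the current prefix
    and the current relation. *)
Lemma history_of_prefix p0 (sigma : seq P) t : (t <= size sigma)%N ->
  history_of p0 (take t sigma) (past_rel (take t sigma) (wimp_rel cls sigma t))
    (size (take t sigma)) = history_of p0 sigma (wimp_rel cls sigma) t.
Proof.
move=> le_t; rewrite size_takel //; apply: eq_history_of => s lt.
  by rewrite nth_take.
exact: past_relE.
Qed.
End Recovery.

Lemma sum_by_class (R : realType) (P : eqType) l (cls : P -> 'I_l) (w : 'I_l -> R)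
    (s : seq P) :
  \sum_(x <- s) w (cls x) = \sum_i w i * (count (fun x => cls x == i) s)%:R.
Proof.
elim: s => [|x s IHs] /=; first by rewrite big_nil big1 // => i _; rewrite mulr0.
rewrite big_cons IHs.
under [in RHS]eq_bigr => i _ do rewrite natrD mulrDr.
rewrite big_split /=; congr (_ + _).
rewrite (bigD1 (cls x)) //= eqxx mulr1 big1 ?addr0 // => i.
by rewrite eq_sym => /negPf ->; rewrite mulr0.
Qed.

Lemma sum_count_class (P : eqType) l (cls : P -> 'I_l) (s : seq P) :
  (\sum_i count (fun x => cls x == i) s = size s)%N.
Proof.
elim: s => [|x s IHs] /=; first by rewrite big1.
rewrite big_split /= IHs (bigD1 (cls x)) //= eqxx big1 => [//|i].
by rewrite eq_sym => /negPf ->.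
Qed.

(** * The soft allocation instance built from a paging run *)

Section SoftCost.
Variables (R : realType) (P : choiceType) (l k : nat) (cls : P -> 'I_l).
Variables (wc : 'I_l -> R) (p0 : P).
Hypotheses (k_gt0 : (0 < k)%N) (wc_gt0 : forall i, 0 < wc i).

Local Notation stack := (class_stack cls).
Local Notation reqs := (requests k cls wc).

(** A slot is the mass [1 / k] of the simplex, so with this weight a change by one slot costs
    [wc i]. *)
Definition soft_weight (i : 'I_l) : R := k%:R * wc i.

Lemma sa_costE (w : 'I_l -> R) q (rs : seq (sa_request R l)) x :
  sa_cost w rs x = (\sum_(0 <= t < size rs)
    ((move_cost w (x t) (x t.+1))%:E +
     sa_fun (nth q rs t) (x t.+1 (sa_dir (nth q rs t)))))%E.
Proof.
by rewrite big_mkord; apply: eq_bigr => t _; rewrite (tnth_nth q).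
Qed.

Section Trace.
Variables (sigma : seq P) (rels : nat -> rel P).
Local Notation h t := (history_of p0 sigma rels t).
Local Notation req t := (nth p0 sigma t).

Lemma nth_requests q T t : (t < T)%N -> nth q (reqs (h T)) t =
  SARequest (cls (req t))
    (request_cost k cls wc (stack (h t) (cls (req t))) (req t)).
Proof.
elim: T => // T IHT; rewrite ltnS leq_eqVlt => lt /=.
rewrite nth_rcons size_requests size_history_of.
by case/predU1P: lt => [->|lt]; rewrite ?ltnn ?eqxx // lt IHT.
Qed.

Lemma take_requests T t : (t <= T)%N -> take t (reqs (h T)) = reqs (h t).
Proof.
elim: T => [|T IHT]; first by rewrite leqn0 => /eqP ->.
rewrite leq_eqVlt => /predU1P[->|lt].
  by rewrite take_oversize // size_requests size_history_of.
by rewrite /= -cats1 takel_cat ?IHT // size_requests size_history_of.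
Qed.

Variables (A : sa_alg R l).
Local Notation slots := (alloc_slots k cls wc A).

Definition soft_step t : R :=
  \sum_i wc i * `|slots (h t.+1) i - slots (h t) i|
  + wc (cls (req t)) * deficit (slots (h t.+1) (cls (req t)))
                         (stack (h t) (cls (req t))) (req t).

(** All terms are nonnegative, so a finite total excludes the infinite branch of every
    [request_cost]. *)
Lemma sa_cost_soft T :
  (sa_cost soft_weight (reqs (h T)) (sa_traj A (reqs (h T))) < +oo)%E ->
  (forall t, (t < T)%N -> 1 <= slots (h t.+1) (cls (req t))) /\
  sa_cost soft_weight (reqs (h T)) (sa_traj A (reqs (h T))) =
    (\sum_(0 <= t < T) soft_step t)%:E.
Proof.
pose q : sa_request R l := SARequest (cls p0) (fun=> 0%E).
rewrite (sa_costE _ q) size_requests size_history_of.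
have termE t : (t < T)%N ->
    ((move_cost soft_weight (sa_traj A (reqs (h T)) t) (sa_traj A (reqs (h T)) t.+1))%:E
     + sa_fun (nth q (reqs (h T)) t)
        (sa_traj A (reqs (h T)) t.+1 (sa_dir (nth q (reqs (h T)) t))) =
     if (slots (h t.+1) (cls (req t)) < 1)%R then +oo else (soft_step t)%:E)%E.
  move=> lt; rewrite nth_requests // /sa_traj !take_requests ?(ltnW lt) //.
  rewrite [sa_fun _]/= [sa_dir _]/= /request_cost -/(slots (h t.+1) _).
  case: ifP => // _; rewrite -EFinD; congr (_ + _)%:E.
  apply: eq_bigr => i _; rewrite /soft_weight /alloc_slots -mulrBr normrM.
  by rewrite (ger0_norm (ler0n _ k)) mulrCA mulrA.
have step_ge0 t : 0 <= soft_step t.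
  rewrite addr_ge0 ?mulr_ge0 ?deficit_ge0 ?(ltW (wc_gt0 _)) //.
  by apply: sumr_ge0 => i _; rewrite mulr_ge0 // ltW.
rewrite big_nat (eq_bigr _ (fun t lt => termE t lt)) -big_nat => fin.
have big t : (t < T)%N -> 1 <= slots (h t.+1) (cls (req t)).
  move=> lt; rewrite leNgt; apply/negP => lt1; move: fin.
  rewrite big_mkord (bigD1 (Ordinal lt)) //= lt1 addye ?ltxx //.
  rewrite gt_eqF //; apply: (@lt_le_trans _ _ 0%E) => //.
  by apply: sume_ge0 => s _; case: ifP => _; rewrite ?lee_fin ?leey.
split=> //; rewrite -sumEFin big_nat [in RHS]big_nat; apply: eq_bigr => t lt.
by rewrite ltNge big.
Qed.
End Trace.

(** * A soft schedule derived from a paging schedule *)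

Section Offline.
Variables (i0 : 'I_l) (sigma : seq P) (C : nat -> {fset P}) (x0 : 'I_l -> R).
Hypotheses (wc_min : forall i, wc i0 <= wc i).
Hypotheses (feas : paging_feasible k sigma C) (x0_in : in_simplex x0).
Local Notation h t := (history_of p0 sigma (wimp_rel cls sigma) t).
Local Notation req t := (nth p0 sigma t).
Local Notation slot t i := (class_slots cls C t i).
Local Notation used t := (\sum_i slot t i)%N.

Local Notation T := (size sigma).

Lemma used_le t : (t < T)%N -> (used t.+1 <= k)%N.
Proof.
move=> lt; have [_ /(_ (Ordinal lt))[_ /=]] := feas.
by rewrite /class_slots sum_count_class.
Qed.

Definition offline_slots t i : R :=
  (slot t i)%:R + (if i == i0 then k%:R - (used t)%:R else 0).

(* The slots left empty by [C] are lent to a class of minimal weight, whose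
   movements are then dominated by those of the other classes. *)
Definition offline_point t : 'I_l -> R :=
  if t is 0 then x0 else fun i => offline_slots t i / k%:R.

Lemma offline_slots_ge t i : (t < T)%N -> (slot t.+1 i)%:R <= offline_slots t.+1 i.
Proof.
move=> lt; rewrite lerDl; case: ifP => // _.
by rewrite subr_ge0 ler_nat used_le.
Qed.

Lemma sum_offline_slots t : \sum_i offline_slots t i = k%:R.
Proof.
rewrite big_split /= -natr_sum -big_mkcond /= big_pred1_eq addrC subrK //.
Qed.

Lemma offline_simplex t : (t <= T)%N -> in_simplex (offline_point t).
Proof.
case: t => // t lt; have k0 : 0 < k%:R :> R by rewrite ltr0n.
have ge0 i : 0 <= offline_slots t.+1 i.
  by apply: le_trans (offline_slots_ge i lt).
split=> [i|]; last by rewrite -mulr_suml sum_offline_slots divff ?gt_eqF.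
rewrite divr_ge0 //= ler_pdivrMr // mul1r -(sum_offline_slots t.+1).
by rewrite (bigD1 i) //= lerDl sumr_ge0.
Qed.

Local Notation slot_change t i := (`|(slot t.+1 i)%:R - (slot t i)%:R| : R).

(** Class [i0] also moves by the change in the number of used slots; at the lowest weight this costs
    at most the slot changes once more. The first move, from the arbitrary [x0], changes each
    coordinate by at most one. *)
Lemma offline_move t : (t < T)%N ->
  move_cost soft_weight (offline_point t) (offline_point t.+1) <=
  2 * \sum_i wc i * slot_change t i + (if t == 0%N then k%:R * \sum_i wc i else 0).
Proof.
move=> lt; have k0 : 0 < k%:R :> R by rewrite ltr0n.
case: t lt => [|t] lt.
  rewrite ler_wpDl ?mulr_ge0 //; first by apply: sumr_ge0 => i _; rewrite mulr_ge0 // ltW.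
  rewrite mulr_sumr; apply: ler_sum => i _.
  rewrite ler_piMr ?mulr_ge0 // ?(ltW (wc_gt0 _)) //.
  have [/(_ i)/andP[a0 a1] _] := offline_simplex lt.
  have [/(_ i)/andP[b0 b1] _] := offline_simplex (leq0n T).
  by rewrite ler_norml; move: a0 a1 b0 b1; lra.
rewrite addr0 /move_cost.
have -> : \sum_i soft_weight i * `|offline_point t.+2 i - offline_point t.+1 i| =
    \sum_i wc i * `|offline_slots t.+2 i - offline_slots t.+1 i|.
  apply: eq_bigr => i _; rewrite /= -mulrBl normrM /soft_weight.
  by rewrite normfV (ger0_norm (ltW k0)); field; rewrite gt_eqF.
have used_change : `|(used t.+2)%:R - (used t.+1)%:R| <= \sum_i slot_change t.+1 i.
  by rewrite !natr_sum -sumrB ler_norm_sum.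
apply: (@le_trans _ _ (\sum_i (wc i * slot_change t.+1 i +
   if i == i0 then wc i * `|(used t.+2)%:R - (used t.+1)%:R| else 0))).
  apply: ler_sum => i _; rewrite /offline_slots; case: ifP => _; last first.
    by rewrite !addr0.
  rewrite -mulrDr ler_pM2l // (distrC (used t.+2)%:R).
  apply: le_trans (ler_normD _ _); rewrite le_eqVlt; apply/orP; left; apply/eqP.
  by congr (`|_|); ring.
rewrite big_split /= -big_mkcond /= big_pred1_eq mulr2n mulrDl mul1r lerD2l.
apply: (@le_trans _ _ (wc i0 * \sum_i slot_change t.+1 i)); first by rewrite ler_pM2l.
by rewrite mulr_sumr; apply: ler_sum => i _; rewrite ler_wpM2r.
Qed.

(** Every change is a load or an eviction, and as [C 0] is empty, evictions never outnumber loads;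
    the slots in use are the surplus kept in the induction. *)
Lemma slot_changes_le i :
  \sum_(0 <= t < T) slot_change t i <= 2 * \sum_(0 <= t < T) (class_loads cls C t i)%:R.
Proof.
suff main n : \sum_(0 <= t < n) slot_change t i + (slot n i)%:R <=
    2 * \sum_(0 <= t < n) (class_loads cls C t i)%:R.
  by apply: le_trans (main T); rewrite lerDl.
elim: n => [|n IHn]; first by rewrite !big_geq // /class_slots (proj1 feas) mulr0 addr0.
rewrite !big_nat_recr //= mulrDr.
have := count_fsetD (fun x => cls x == i) (C n) (C n.+1).
rewrite -/(class_loads cls C n i) -/(slot n i) -/(slot n.+1 i) => /(congr1 (fun m => m%:R : R)).
rewrite !natrD; move: (count _ _) => e.
have e0 : 0 <= e%:R :> R by [].
have L0 : 0 <= (class_loads cls C n i)%:R :> R by [].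
move=> eqn; have H : slot_change n i <= (class_loads cls C n i)%:R + e%:R :> R.
  by rewrite ler_norml; move: eqn e0 L0; lra.
by move: IHn H eqn; lra.
Qed.

Lemma paging_cost_by_class : paging_cost (fun p => wc (cls p)) sigma C =
  \sum_i wc i * \sum_(0 <= t < T) (class_loads cls C t i)%:R.
Proof.
rewrite /paging_cost.
under eq_bigr => t _ do rewrite sum_by_class.
by rewrite exchange_big /=; apply: eq_bigr => i _; rewrite -mulr_sumr big_mkord.
Qed.

(** The requested page occupies a slot of its class, which makes the cost finite; the deficit
    vanishes unless the stack faults. *)
Lemma offline_request t : (t < T)%N ->
  (request_cost k cls wc (stack (h t) (cls (req t))) (req t)
     (offline_point t.+1 (cls (req t))) <=
   (\sum_i wc i * (class_fault cls p0 sigma C t i)%:R)%:E)%E.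
Proof.
move=> lt; set r := cls (req t).
have req_in : req t \in C t.+1.
  by have [_ /(_ (Ordinal lt))[]] := feas; rewrite (tnth_nth p0).
have slot_gt0 : (0 < slot t.+1 r)%N.
  by rewrite -has_count; apply/hasP; exists (req t).
rewrite /request_cost /= mulrCA divff ?mulr1; last by rewrite pnatr_eq0 -lt0n.
have ge := offline_slots_ge r lt.
rewrite ltNge (le_trans _ ge) ?ler1n //= lee_fin (bigD1 r) //=.
apply: ler_wpDr; first by apply: sumr_ge0 => i _; rewrite mulr_ge0 // ltW.
rewrite ler_pM2l //; apply: le_trans (deficit_nincr _ _ ge) _.
rewrite /class_fault eqxx /=; case: (boolP (_ \in _)) => [/deficit_nat ->|_] //=.
exact: deficit_le1.
Qed.

(** The 6 is 4 for moves, where lending to [i0] and counting evictions each double the loads, plus 2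
    for faults by [class_faults_le]. *)
Lemma sa_opt_le : (sa_opt soft_weight x0 (reqs (h T)) <=
  (6 * paging_cost (fun p => wc (cls p)) sigma C + k%:R * \sum_i wc i)%:E)%E.
Proof.
apply: (@le_trans _ _ (sa_cost soft_weight (reqs (h T)) offline_point)).
  apply: ereal_inf_lbound; exists offline_point => //; split=> // t.
  by rewrite size_requests size_history_of; apply: offline_simplex.
pose q : sa_request R l := SARequest (cls p0) (fun=> 0%E).
rewrite (sa_costE _ q) size_requests size_history_of.
pose step t := 2 * \sum_i wc i * slot_change t i
  + (if t == 0%N then k%:R * \sum_i wc i else 0)
  + \sum_i wc i * (class_fault cls p0 sigma C t i)%:R.
apply: (@le_trans _ _ (\sum_(0 <= t < T) (step t)%:E)%E).
  rewrite big_nat [X in (_ <= X)%E]big_nat; apply: lee_sum => t /= lt.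
  rewrite nth_requests // /step EFinD; apply: leeD.
    by rewrite lee_fin offline_move.
  exact: offline_request.
rewrite sumEFin lee_fin !big_split /= paging_cost_by_class.
have changes : \sum_(0 <= t < T) 2 * \sum_i wc i * slot_change t i <=
    4 * \sum_i wc i * \sum_(0 <= t < T) (class_loads cls C t i)%:R.
  rewrite -mulr_sumr exchange_big /= (_ : 4 = 2 * 2) -?mulrA; last by rewrite -natrM.
  rewrite ler_pM2l // mulr_sumr; apply: ler_sum => i _.
  by rewrite -mulr_sumr mulrCA ler_pM2l // slot_changes_le.
have faults : \sum_(0 <= t < T) \sum_i wc i * (class_fault cls p0 sigma C t i)%:R <=
    2 * \sum_i wc i * \sum_(0 <= t < T) (class_loads cls C t i)%:R.
  rewrite exchange_big /= mulr_sumr; apply: ler_sum => i _.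
  rewrite -mulr_sumr mulrCA ler_pM2l // !big_mkord -!natr_sum -natrM ler_nat.
  exact: class_faults_le feas.
have start : \sum_(0 <= t < T) (if t == 0%N then k%:R * \sum_i wc i else 0) <=
    k%:R * \sum_i wc i.
  have ge0 : 0 <= k%:R * \sum_i wc i.
    by rewrite mulr_ge0 // sumr_ge0 // => i _; rewrite ltW.
  case: T => [|n]; first by rewrite big_geq.
  by rewrite big_nat_recl //= [X in _ + X]big1 ?addr0.
by move: changes faults start; lra.
Qed.
End Offline.
End SoftCost.

(** * Uniform dyadic seeds *)

Section Seed.
Variable R : realType.
Implicit Types (x : R) (t j : nat).

(** The number formed by the first [t] binary digits of [x]. Seeds outside the unit interval get row
    0, so that feasibility holds for every seed. *)
Definition seed_row t x : nat := if x < 1 then Num.truncn (2 ^+ t * x) else 0%N.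

Lemma seed_row_lt t x : (seed_row t x < 2 ^ t)%N.
Proof.
rewrite /seed_row; case: ifP => [lt1|_]; last by rewrite expn_gt0.
have [ge0|lt0] := leP 0 x; last first.
  rewrite truncn_floor leNgt pmulr_rlt0 ?exprn_gt0 // lt0 /=.
  by rewrite expn_gt0.
by rewrite truncn_lt_nat ?mulr_ge0 ?exprn_ge0 // natrX gtr_pMr ?exprn_gt0.
Qed.

(** Dropping the last digit leads to the parent row; this couples the allocations of consecutive
    times. *)
Lemma seed_row_half t x : (seed_row t.+1 x)./2 = seed_row t x.
Proof.
rewrite /seed_row; case: ifP => // _.
have [ge0|lt0] := leP 0 x; last first.
  by rewrite !truncn_floor !leNgt !pmulr_rlt0 ?exprn_gt0 // lt0.
have ge0' : 0 <= 2 ^+ t * x by rewrite mulr_ge0 ?exprn_ge0.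
have /andP[le_n lt_n] := truncn_itv ge0'.
set n := Num.truncn (2 ^+ t * x) in le_n lt_n *.
have ge0'' : 0 <= 2 * (2 ^+ t * x) by rewrite mulr_ge0.
rewrite exprS -mulrA.
have lo : (n * 2 <= Num.truncn (2 * (2 ^+ t * x)))%N.
  by rewrite truncn_ge_nat // natrM mulrC ler_pM2l.
have hi : (Num.truncn (2 * (2 ^+ t * x)) < n.+1 * 2)%N.
  by rewrite truncn_lt_nat // natrM [X in _ < X]mulrC ltr_pM2l.
lia.
Qed.

Definition dyadic t j : set R := `[j%:R / 2 ^+ t, j.+1%:R / 2 ^+ t[%classic.

Lemma dyadicE t j x : (j < 2 ^ t)%N ->
  (x \in dyadic t j) = (0 <= x < 1) && (seed_row t x == j).
Proof.
move=> lt_j; have pow_gt0 : 0 < 2 ^+ t :> R by rewrite exprn_gt0.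
have -> : (x \in dyadic t j) = (j%:R / 2 ^+ t <= x < j.+1%:R / 2 ^+ t).
  by apply/idP/idP; rewrite in_setE /dyadic /= in_itv.
rewrite /seed_row ler_pdivrMr // ltr_pdivlMr // mulrC.
have [ge0|lt0] := leP 0 x; last first.
  apply/andP => -[le_j _]; have := le_trans (ler0n R j) le_j.
  by rewrite leNgt pmulr_rlt0 // lt0.
have [lt1|ge1] /= := ltP x 1; first by rewrite truncn_eq // mulr_ge0 // ltW.
apply/andP => -[_]; rewrite ltNge => /negP; apply.
apply: (@le_trans _ _ (2 ^+ t)); last by rewrite ler_peMr // ltW.
by rewrite -natrX ler_nat.
Qed.

(** A step function on the whole line, with base value [g 0] off the unit interval; this form gives
    measurability. *)
Lemma seed_rowE t (g : nat -> R) x : g (seed_row t x) =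
  g 0%N + \sum_(j < 2 ^ t) (g j - g 0%N) * \1_(dyadic t j) x.
Proof.
have [in01|out01] := boolP (0 <= x < 1).
  rewrite (bigD1 (Ordinal (seed_row_lt t x))) //= big1 => [|j].
    by rewrite indicE dyadicE ?seed_row_lt // in01 eqxx mulr1 addr0 addrC subrK.
  rewrite -val_eqE /= eq_sym => /negPf ne.
  by rewrite indicE dyadicE // ne andbF mulr0.
rewrite big1 => [|j _]; last by rewrite indicE dyadicE // (negPf out01) mulr0.
rewrite addr0; congr g; rewrite /seed_row; case: ifP => // lt1.
rewrite lt1 andbT -ltNge in out01.
by rewrite truncn_floor leNgt pmulr_rlt0 ?exprn_gt0 // out01.
Qed.

Lemma measurable_seed_row t (g : nat -> R) :
  measurable_fun setT (fun x : measurableTypeR R => g (seed_row t x)).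
Proof.
rewrite (_ : (fun x => _) = (fun x => g 0%N +
    \sum_(j < 2 ^ t) (g j - g 0%N) * \1_(dyadic t j) x)); last first.
  by apply/funext => x; apply: seed_rowE.
apply: measurable_funD; first exact: measurable_cst.
apply: measurable_sum => j; apply: measurable_funM; first exact: measurable_cst.
by apply: measurable_indic; apply: measurable_itv.
Qed.

Lemma integral_seed_row t (g : nat -> R) : (forall j, 0 <= g j) ->
  (\int[uniform_prob (@ltr01 R)]_x (g (seed_row t x))%:E =
   ((\sum_(j < 2 ^ t) g j) / 2 ^+ t)%:E)%E.
Proof.
move=> g0; have pow_gt0 : 0 < 2 ^+ t :> R by rewrite exprn_gt0.
have mg : measurable_fun setT (fun x : measurableTypeR R => (g (seed_row t x))%:E).
  by apply/measurable_EFinP; apply: measurable_seed_row.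
rewrite integral_uniform //; last by move=> x; rewrite lee_fin.
(* The dyadic intervals are half-open and miss the point 1, which has measure zero. *)
rewrite subr0 invr1 mul1e -integral_itv_bndo_bndc; last first.
  by apply: measurable_funS mg.
transitivity (\int[lebesgue_measure]_(x in `[0%R, 1%R[)
    (\sum_(j < 2 ^ t) (g j * \1_(dyadic t j) x)%:E))%E.
  apply: eq_integral => x; rewrite in_setE /= in_itv /= => in01.
  rewrite sumEFin; congr (_%:E).
  rewrite (bigD1 (Ordinal (seed_row_lt t x))) //= big1 => [|j].
    by rewrite indicE dyadicE ?seed_row_lt // in01 eqxx mulr1 addr0.
  rewrite -val_eqE /= eq_sym => /negPf ne.
  by rewrite indicE dyadicE // ne andbF mulr0.
rewrite ge0_integral_sum //=; first last.
- by move=> j x _; rewrite lee_fin mulr_ge0.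
- move=> j; apply/measurable_EFinP; apply: measurable_funM; first exact: measurable_cst.
  by apply: measurable_indic; apply: measurable_itv.
rewrite mulr_suml -sumEFin; apply: eq_bigr => j _.
under eq_integral do rewrite EFinM.
rewrite ge0_integralZl_EFin //; last first.
  by apply/measurable_EFinP; apply: measurable_indic; apply: measurable_itv.
rewrite integral_indic //; last exact: measurable_itv.
rewrite EFinM; congr (_ * _)%E.
rewrite (_ : _ `&` _ = dyadic t j)%classic; last first.
  apply/seteqP; split=> [x []//|x xin]; split => //.
  by have := mem_set xin; rewrite dyadicE // => /andP[in01 _]; rewrite /= in_itv.
transitivity (lebesgue_measure (dyadic t j : set R)) => [//|].
rewrite /dyadic lebesgue_measure_itv /= lte_fin ltr_pM2r ?invr_gt0 // ltr_nat ltnSn.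
by rewrite -EFinB -mulrBl -natrB // subSnn mul1r.
Qed.
End Seed.

(** * Expected cost *)

(** More than [b] requests of constant cost 1 cost any algorithm more than [b], while a negative
    [rho] would bound the cost by [b]. *)
Lemma sa_competitive_ge0 (R : realType) l (i0 : 'I_l) (w : 'I_l -> R)
    (A : sa_alg R l) rho :
  (forall i, 0 < w i) -> sa_alg_valid A -> sa_competitive w A rho -> 0 <= rho.
Proof.
move=> w_gt0 vA [b compb]; rewrite leNgt; apply/negP => rho_lt0.
pose q := SARequest i0 (fun=> 1%E : \bar R).
set rs := nseq (Num.truncn `|b|).+1 q.
have vrs : sa_valid_seq rs.
  by move=> t; rewrite (tnth_nth q) nth_nseq if_same; split.
have move_ge0 x y : 0 <= move_cost w x y.
  by apply: sumr_ge0 => i _; rewrite mulr_ge0 // ltW.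
have step_ge1 x t : (t < size rs)%N ->
    (1 <= (move_cost w (x t) (x t.+1))%:E
         + sa_fun (nth q rs t) (x t.+1 (sa_dir (nth q rs t))))%E.
  by move=> _; rewrite nth_nseq if_same -EFinD lee_fin lerDr.
have cost_ge x : ((size rs)%:R%:E <= sa_cost w rs x)%E.
  rewrite (sa_costE _ q) big_mkord -[X in X%:R](card_ord (size rs)) -sumr_const -sumEFin.
  by apply: lee_sum => t _; apply: step_ge1.
have opt_ge0 : (0 <= sa_opt w (A [::]) rs)%E.
  apply: le_ereal_inf_tmp => _ [y _ <-]; apply: le_trans (cost_ge y).
  by rewrite lee_fin.
have := le_trans (cost_ge _) (compb rs vrs).
apply/negP; rewrite -ltNge; apply: (@le_lt_trans _ _ b%:E).
  rewrite -[leRHS]add0e leeD2r // mule_le0_ge0 // lee_fin; exact: ltW.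
rewrite lte_fin size_nseq; apply: (le_lt_trans (ler_norm b)).
exact: truncnS_gt.
Qed.

Lemma paging_feasible_exists (P : choiceType) (p0 : P) k (sigma : seq P) :
  (0 < k)%N ->
  paging_feasible k sigma (fun t => if t is t'.+1 then [fset nth p0 sigma t']%fset
                                    else fset0).
Proof.
move=> k0; split=> // t; rewrite (tnth_nth p0) /= inE eqxx; split=> //.
by rewrite cardfs1.
Qed.

Lemma sum_geometric_half (R : realType) n :
  \sum_(0 <= t < n) 2 ^- t = 2 - 2 * 2 ^- n :> R.
Proof.
elim: n => [|n IHn]; first by rewrite big_geq // expr0 invr1 mulr1 subrr.
rewrite big_nat_recr //= IHn exprS invfM.
by move: (2 ^- n) => x; field.
Qed.

(** * The randomized algorithm and its competitive ratio *)

Section Wimp.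
Variables (R : realType) (P : choiceType) (l k : nat) (cls : P -> 'I_l).
Variables (wc : 'I_l -> R) (A : sa_alg R l) (i0 : 'I_l) (p0 : P).
Hypotheses (k_gt0 : (0 < k)%N) (wc_gt0 : forall i, 0 < wc i).
Hypotheses (wc_min : forall i, wc i0 <= wc i) (A_valid : sa_alg_valid A).
Variables (rho b : R).
Hypothesis rho_ge0 : 0 <= rho.
Hypothesis A_comp : forall rs, sa_valid_seq rs ->
  (sa_cost (soft_weight k wc) rs (sa_traj A rs) <=
   rho%:E * sa_opt (soft_weight k wc) (A [::]) rs + b%:E)%E.

Local Notation W := (\sum_i wc i).
Local Notation row := (row_cache k cls wc A i0).

Definition wimp_of_sa : wimp_alg P (measurableTypeR R) := fun om pre r =>
  row (history_of p0 pre (past_rel cls pre r) (size pre)) (seed_row (size pre) om).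

Section Run.
Variable sigma : seq P.
Local Notation T := (size sigma).
Local Notation h t := (history_of p0 sigma (wimp_rel cls sigma) t).
Local Notation req t := (nth p0 sigma t).
Local Notation wt := (fun p => wc (cls p)).
Local Notation slots := (alloc_slots k cls wc A).
Local Notation grid := (grid k cls wc A).
Local Notation step t := (soft_step k cls wc p0 sigma (wimp_rel cls sigma) A t).
Local Notation loads t j :=
  (row_loads k cls wc A i0 (req t, wimp_rel cls sigma t.+1) (h t) j).

Lemma wimp_cacheE om t : (t <= T)%N ->
  wimp_cache cls wimp_of_sa om sigma t = row (h t) (seed_row t om).
Proof.
case: t => [|t] le_t; first by rewrite row_cache_nil.
by rewrite /wimp_cache /wimp_of_sa history_of_prefix // size_takel.
Qed.

(** Any feasible [C] bounds the soft optimum, so the soft cost is finite and each requested class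
    holds a full slot. *)
Lemma soft_run_le C : paging_feasible k sigma C ->
  (forall t, (t < T)%N -> 1 <= slots (h t.+1) (cls (req t))) /\
  \sum_(0 <= t < T) step t <= rho * (6 * paging_cost wt sigma C + k%:R * W) + b.
Proof.
move=> feas; have bound := A_comp (@requests_valid R P l k cls wc wc_gt0 (h T)).
have A0 : in_simplex (A [::]) by apply: A_valid => -[].
have := sa_opt_le cls p0 k_gt0 wc_gt0 wc_min feas A0; set c := (6 * _ + _) => opt_le.
have {}bound : (sa_cost (soft_weight k wc) (requests k cls wc (h T))
    (sa_traj A (requests k cls wc (h T))) <= (rho * c + b)%:E)%E.
  by apply: le_trans bound _; rewrite EFinD leeD2r // EFinM lee_wpmul2l ?lee_fin.
have [big costE] := sa_cost_soft wc_gt0 (le_lt_trans bound (ltry _)).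
by split=> //; rewrite -lee_fin -costE.
Qed.

Lemma wimp_feasible om : paging_feasible k sigma (wimp_cache cls wimp_of_sa om sigma).
Proof.
(* Caching only the requested page is schedule enough to make the soft cost finite. *)
have [big _] := soft_run_le (paging_feasible_exists p0 sigma k_gt0).
split=> // t; have lt := ltn_ord t; rewrite (tnth_nth p0) wimp_cacheE //; split.
  apply: row_cache_top => //; first exact: big.
  by rewrite size_history_of; apply: seed_row_lt.
apply: card_row_cache => //; rewrite size_history_of; exact: seed_row_lt.
Qed.

Lemma wimp_cost_rows om :
  paging_cost wt sigma (wimp_cache cls wimp_of_sa om sigma) =
  \sum_(0 <= t < T) loads t (seed_row t.+1 om).
Proof.
rewrite /paging_cost big_mkord; apply: eq_bigr => t _; have lt := ltn_ord t.
by rewrite (wimp_cacheE om (ltnW lt)) (wimp_cacheE om lt) /row_loads seed_row_half.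
Qed.

Lemma wimp_cost_measurable : measurable_fun setT
  (fun om => paging_cost wt sigma (wimp_cache cls wimp_of_sa om sigma)).
Proof.
rewrite (_ : (fun om => _) =
    (fun om => \sum_(0 <= t < T) loads t (seed_row t.+1 om))); last first.
  by apply/funext => om; apply: wimp_cost_rows.
apply: measurable_sum => t; exact: measurable_seed_row.
Qed.

Lemma expected_loads_le t : (\sum_(j < 2 ^ t.+1) loads t j) / 2 ^+ t.+1 <=
  10 * step t + 16 * k%:R * W * 2 ^- t.
Proof.
rewrite ler_pdivrMr ?exprn_gt0 // mulrC.
set e := (req t, wimp_rel cls sigma t.+1); set r := cls (req t).
have := sum_row_loads_le cls A k_gt0 wc_gt0 wc_min e (h t).
rewrite size_history_of => /le_trans; apply; rewrite ler_pM2l ?exprn_gt0 //.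
have half : 2 ^- t.+1 = 2 ^- t / 2 :> R by rewrite exprS invfM mulrC.
pose eps : R := k%:R * 2 ^- t.
have eps_ge0 : 0 <= eps by rewrite mulr_ge0 // invr_ge0 exprn_ge0.
have err0 i : `|(grid (h t) i)%:~R / 2 ^+ t - slots (h t) i| <= eps.
  by have := grid_err cls k_gt0 wc_gt0 A_valid (h t) i; rewrite size_history_of.
have err1 i : `|(grid (e :: h t) i)%:~R / 2 ^+ t.+1 - slots (e :: h t) i| <= eps / 2.
  have := grid_err cls k_gt0 wc_gt0 A_valid (e :: h t) i.
  by rewrite /= size_history_of => /le_trans; apply; rewrite half mulrA.
have moves : \sum_i wc i *
      `|(grid (e :: h t) i)%:~R / 2 ^+ t.+1 - (grid (h t) i)%:~R / 2 ^+ t| <=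
    \sum_i wc i * `|slots (e :: h t) i - slots (h t) i| + W * (3 / 2 * eps).
  rewrite mulr_suml -big_split /=; apply: ler_sum => i _.
  rewrite -mulrDr ler_pM2l //; have := err0 i; have := err1 i.
  move: ((grid (e :: h t) i)%:~R / _) ((grid (h t) i)%:~R / _) => a c.
  move: (slots (e :: h t) i) (slots (h t) i) => s s'.
  have -> : a - c = (a - s) + (s - s') + (s' - c) by ring.
  move=> le1; rewrite distrC => le0.
  apply: le_trans (ler_normD _ _) _.
  have := ler_normD (a - s) (s - s'); lra.
have faults : wc r * deficit ((grid (e :: h t) r)%:~R / 2 ^+ t.+1)
      (class_stack cls (h t) r) (req t) <=
    wc r * deficit (slots (e :: h t) r) (class_stack cls (h t) r) (req t)
      + W * (eps / 2).
  apply: (@le_trans _ _ (wc r * deficit (slots (e :: h t) r)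
      (class_stack cls (h t) r) (req t) + wc r * (eps / 2))).
    rewrite -mulrDr ler_pM2l //; apply: le_trans (deficit_lipschitz _ _ _ _) _.
    exact: lerD.
  rewrite lerD2l ler_wpM2r ?divr_ge0 // (bigD1 r) //= lerDl sumr_ge0 // => i _.
  exact: ltW.
(* Rounding errs by [eps] at time [t] and [eps / 2] at [t.+1]: ten times [3 / 2] for the moves and
   [1 / 2] for the fault, at most 16 in all. *)
have Weps : 16 * k%:R * W * 2 ^- t = 16 * (W * eps) by rewrite /eps; ring.
have Weps_ge0 : 0 <= W * eps.
  by rewrite mulr_ge0 // sumr_ge0 // => i _; apply: ltW.
have step_fault : 0 <= wc r * deficit (slots (e :: h t) r) (class_stack cls (h t) r) (req t).
  by rewrite mulr_ge0 ?deficit_ge0 // ltW.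
rewrite Weps /soft_step -/e -/r [history_of _ _ _ t.+1]/= -/e.
have e1 : W * (3 / 2 * eps) = 3 / 2 * (W * eps) by ring.
have e2 : W * (eps / 2) = (W * eps) / 2 by field.
move: moves faults step_fault Weps_ge0; rewrite e1 e2.
move: (W * eps) => x; lra.
Qed.

Lemma wimp_expected_cost C : paging_feasible k sigma C ->
  (\int[uniform_prob (@ltr01 R)]_om
     (paging_cost wt sigma (wimp_cache cls wimp_of_sa om sigma))%:E <=
   (60 * rho * paging_cost wt sigma C +
     (10 * (rho * (k%:R * W) + b) + 32 * k%:R * W))%:E)%E.
Proof.
move=> feas; have [_ soft] := soft_run_le feas.
have loads_ge0 t j : 0 <= loads t j.
  by apply: sumr_ge0 => x _; apply: ltW.
under eq_integral do rewrite wimp_cost_rows -sumEFin.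
rewrite ge0_integral_sum //=; first last.
- by move=> t om _; rewrite lee_fin.
- move=> t; apply/measurable_EFinP; exact: measurable_seed_row.
rewrite (eq_bigr (fun t => ((\sum_(j < 2 ^ t.+1) loads t j) / 2 ^+ t.+1)%:E)); last first.
  by move=> t _; rewrite (integral_seed_row t.+1 (loads_ge0 t)).
rewrite sumEFin lee_fin.
(* The 60 is 10 times the 6 of [sa_opt_le]; the geometric sum of the rounding errors turns 16 into
   32. *)
apply: (@le_trans _ _ (\sum_(0 <= t < T) (10 * step t + 16 * k%:R * W * 2 ^- t))).
  by apply: ler_sum => t _; apply: expected_loads_le.
rewrite big_split /= -!mulr_sumr sum_geometric_half.
have kW : 0 <= k%:R * W * 2 ^- T.
  rewrite !mulr_ge0 ?invr_ge0 ?exprn_ge0 // sumr_ge0 // => i _; exact: ltW.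
move: soft kW; move: (\sum_(0 <= t < T) _) (paging_cost _ _ _) W (2 ^- T).
by move=> s pc w x; lra.
Qed.
End Run.

Lemma wimp_of_sa_competitive :
  wimp_rand_competitive k cls wc (uniform_prob (@ltr01 R)) wimp_of_sa (60 * rho).
Proof.
split; first by move=> om sigma; apply: wimp_feasible.
split; first exact: wimp_cost_measurable.
pose b' := 10 * (rho * (k%:R * W) + b) + 32 * k%:R * W.
exists b' => sigma; set wt := fun p => wc (cls p).
set cost := (\int[_]_om _)%E.
have upper C : paging_feasible k sigma C ->
    (cost <= (60 * rho * paging_cost wt sigma C + b')%:E)%E.
  exact: wimp_expected_cost.
have feas0 := paging_feasible_exists p0 sigma k_gt0.
set opt := paging_opt _ _ _.
have cost_ge0 C : 0 <= paging_cost wt sigma C.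
  by apply: sumr_ge0 => t _; apply: sumr_ge0 => x _; apply: ltW (wc_gt0 _).
have opt_ge0 : (0 <= opt)%E.
  by apply: le_ereal_inf_tmp => _ [C _ <-]; rewrite lee_fin; apply: cost_ge0.
have opt_le C : paging_feasible k sigma C -> (opt <= (paging_cost wt sigma C)%:E)%E.
  by move=> feas; apply: ereal_inf_lbound; exists C.
have opt_fin : opt \is a fin_num.
  by rewrite ge0_fin_numE // (le_lt_trans (opt_le _ feas0)) ?ltry.
rewrite -(fineK opt_fin) -EFinM -EFinD.
apply/lee_addgt0Pr => e e_gt0; rewrite -EFinD.
(* A schedule within [e / (60 * rho + 1)] of the infimum suffices; the added 1 keeps the divisor
   positive when [rho] is 0. *)
have c_gt0 : 0 < 60 * rho + 1 by rewrite ltr_wpDl ?mulr_ge0.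
have [_ [C feas <-] ltC] :=
  lb_ereal_inf_adherent (divr_gt0 e_gt0 c_gt0) opt_fin.
apply: le_trans (upper C feas) _; rewrite lee_fin.
have : ((paging_cost wt sigma C)%:E < opt + (e / (60 * rho + 1))%:E)%E := ltC.
rewrite -(fineK opt_fin) -EFinD lte_fin => /ltW le_pc.
have c_ge0 : 0 <= 60 * rho by rewrite mulr_ge0.
have := ler_wpM2l c_ge0 le_pc; rewrite mulrDr.
have : 60 * rho * (e / (60 * rho + 1)) <= e.
  rewrite mulrCA ler_piMr ?(ltW e_gt0) // ler_pdivrMr // mul1r lerDl //.
move: (60 * rho * (e / _)) => v; lra.
Qed.
End Wimp.

Theorem theorem3 :
  exists C : nat, (0 < C)%N /\
  forall (R : realType) (phi : nat -> R) (l : nat), (0 < l)%N ->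
  (forall w : 'I_l -> R, (forall i, 0 < w i) ->
     exists A : sa_alg R l, sa_alg_valid A /\ sa_competitive w A (phi l)) ->
  forall (P : choiceType) (k : nat) (cls : P -> 'I_l) (wc : 'I_l -> R),
    (0 < k)%N -> (forall i, 0 < wc i) -> injective wc ->
    (forall i, exists p, cls p = i) ->
    exists (d : measure_display) (Omega : measurableType d)
           (Pr : probability Omega R) (alg : wimp_alg P Omega),
      wimp_rand_competitive k cls wc Pr alg (C%:R * phi l).
Proof.
exists 60; split=> // R phi l l_gt0 sa P k cls wc k_gt0 wc_gt0 _ cls_surj.
have [p0 _] := cls_surj (Ordinal l_gt0).
have [i0 wc_min] : exists i0, forall i, wc i0 <= wc i.
  exists [arg min_(i < Ordinal l_gt0) wc i]%O => i.
  by case: arg_minP => // j _; apply.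
have w_gt0 i : 0 < soft_weight k wc i by rewrite mulr_gt0 ?ltr0n.
have [A [A_valid A_comp]] := sa _ w_gt0.
have phi_ge0 := sa_competitive_ge0 i0 w_gt0 A_valid A_comp.
have [b A_comp'] := A_comp.
exists _, (measurableTypeR R), (uniform_prob (@ltr01 R)), (wimp_of_sa k cls wc A i0 p0).
exact: wimp_of_sa_competitive A_comp'.
Qed.
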